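(* Let $0<\alpha<1$ and $(k,i)\in\{(1,1),(2,1),(2,2)\}$. Then the method is $A(\frac{\pi}{2})$-stable, i.e. the sector $\{z\in\mathbb{C}:\ z\neq 0,\ |\arg(-z)|\le \frac{\pi}{2}\}$ is contained in the stability region $S^{(k,i)}$ defined in the context.
   Context: Uniform grid $t_n=n\Delta t$, $\Delta t>0$, $I_j=[t_{j-1},t_j]$. For a function $u$ and integers $m\ge1$, $j$, $q$, let $p^{m}_{j,q}$ be the polynomial of degree at most $m$ interpolating $u$ at $t_{j+q-m-1},\dots,t_{j+q-1}$. For $1\le i\le k$ and $n\ge k$, let $P^{k}_{i,n}$ be the continuous piecewise polynomial on $[0,t_n]$ equal on $I_j$ to $p^{k-1}_{j,k-j}$ for $1\le j\le k-i$, to $p^{k}_{j,i}$ for $k-i+1\le j\le n-i+1$, and to $p^{k}_{j,n+1-j}$ for $n-i+2\le j\le n$, and set $D^{\alpha}_{k,i}u_n=\frac{1}{\Gamma(1-\alpha)}\int_0^{t_n}(t_n-\xi)^{-\alpha}(P^{k}_{i,n})'(\xi)\,\mathrm{d}\xi$. This is a linear combination of $u_0,\dots,u_n$ ($u_j=u(t_j)$); for $k\le j\le n$ the coefficient of $u_j$ in $(\Delta t)^{\alpha}D^{\alpha}_{k,i}u_n$ depends only on $n-j$ and is denoted $\omega^{(k,i)}_{n-j}$ (defining $\omega^{(k,i)}_m$ for all $m\ge0$), and $w^{(k,i)}_{n,j}$ ($0\le j\le k-1$) are defined by $(\Delta t)^{\alpha}D^{\alpha}_{k,i}u_n=\sum_{j=0}^{k-1}w^{(k,i)}_{n,j}u_j+\sum_{j=0}^{n}\omega^{(k,i)}_{n-j}u_j$.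 With $z=\lambda(\Delta t)^{\alpha}$, the stability region $S^{(k,i)}$ is the set of $z\in\mathbb{C}$ such that for every choice of bounded starting values $u_0,\dots,u_{k-1}$ the recursion $\sum_{j=0}^{k-1}w^{(k,i)}_{n,j}u_j+\sum_{j=0}^{n}\omega^{(k,i)}_{n-j}u_j=z u_n$ ($n\ge k$) determines $(u_n)_{n\ge k}$ and $u_n\to0$. Here $\arg$ takes values in $[-\pi,\pi]$. *)

(* Defs.v *)
From HB Require Import structures.
From mathcomp Require Import all_boot all_order all_algebra.
From mathcomp Require Import all_classical all_reals all_analysis.
From mathcomp Require Import complex.
Set Implicit Arguments. Unset Strict Implicit. Unset Printing Implicit Defensive.
Import Order.TTheory GRing.Theory Num.Theory.
Import numFieldNormedType.Exports.
Local Open Scope classical_set_scope.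
Local Open Scope complex_scope.
Local Open Scope ring_scope.

Section FracBDF.
Variable R : realType.

Definition Gamma (s : R) : R :=
  fine (\int[@lebesgue_measure R]_(x in `[0%R, +oo[) ((x `^ (s - 1)) * expR (- x))%:E)%E.

Definition tg (dt : R) (n : nat) : R := n%:R * dt.

Definition lagrange (dt : R) (u : nat -> R) (s m : nat) : {poly R} :=
  \sum_(a < m.+1) u (s + a)%N *:
     \prod_(b < m.+1 | b != a)
        (('X - (tg dt (s + b)%N)%:P) * ((tg dt (s + a)%N - tg dt (s + b)%N)^-1)%:P).

Definition pinterp (dt : R) (u : nat -> R) (m j q : nat) : {poly R} :=
  lagrange dt u (j + q - m - 1)%N m.

(* The polynomial that P^k_{i,n} equals on I_j = [t_{j-1}, t_j], 1 <= j <= n. *)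
Definition piece (dt : R) (u : nat -> R) (k i n j : nat) : {poly R} :=
  if (j <= k - i)%N then pinterp dt u k.-1 j (k - j)
  else if (j <= n - i + 1)%N then pinterp dt u k j i
  else pinterp dt u k j (n + 1 - j).

(* D^alpha_{k,i} u_n = 1/Gamma(1-alpha) int_0^{t_n} (t_n - xi)^(-alpha) (P^k_{i,n})'(xi) dxi,
   the integral over [0,t_n] being split over the intervals I_j, on which
   (P^k_{i,n})' is the derivative of the corresponding polynomial piece. *)
Definition Dfrac (alpha dt : R) (k i : nat) (u : nat -> R) (n : nat) : R :=
  (Gamma (1 - alpha))^-1 *
  \sum_(1 <= j < n.+1)
     fine (\int[@lebesgue_measure R]_(x in `[tg dt j.-1, tg dt j])
             (((tg dt n - x) `^ (- alpha)) * ((piece dt u k i n j)^`()).[x])%:E)%E.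

(* coefficient of u_j in (dt)^alpha D^alpha_{k,i} u_n  (D is linear in u) *)
Definition coefD (alpha dt : R) (k i n j : nat) : R :=
  dt `^ alpha * Dfrac alpha dt k i (fun l => (l == j)%:R) n.

(* omega^{(k,i)}_m : the coefficient of u_j in (dt)^alpha D u_n for k <= j <= n, n - j = m *)
Definition omega (alpha dt : R) (k i m : nat) : R := coefD alpha dt k i (m + k) k.

Definition wstart (alpha dt : R) (k i n j : nat) : R :=
  coefD alpha dt k i n j - omega alpha dt k i (n - j).

Definition recursion (alpha dt : R) (k i : nat) (z : R[i]) (u : nat -> R[i]) : Prop :=
  forall n : nat, (k <= n)%N ->
    \sum_(j < k) (wstart alpha dt k i n j)%:C * u j
    + \sum_(j < n.+1) (omega alpha dt k i (n - j))%:C * u j = z * u n.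

Definition in_stab_region (alpha dt : R) (k i : nat) (z : R[i]) : Prop :=
  forall u0 : nat -> R[i],
    (exists u : nat -> R[i],
        (forall j, (j < k)%N -> u j = u0 j) /\ recursion alpha dt k i z u)
    /\ (forall u v : nat -> R[i],
          (forall j, (j < k)%N -> u j = u0 j) -> recursion alpha dt k i z u ->
          (forall j, (j < k)%N -> v j = u0 j) -> recursion alpha dt k i z v ->
          forall n, u n = v n)
    /\ (forall u : nat -> R[i],
          (forall j, (j < k)%N -> u j = u0 j) -> recursion alpha dt k i z u ->
          (fun n => ComplexField.Normc.normc (u n)) @ \oo --> (0 : R)).

Definition sector_halfplane (z : R[i]) : Prop :=
  z != 0 /\
  exists theta : R, - (pi / 2) <= theta <= pi / 2 /\
    - z = (ComplexField.Normc.normc z)%:C * (cos theta +i* sin theta).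

End FracBDF.

(* Main.v *)
Require Import Defs.
From HB Require Import structures.
From mathcomp Require Import all_boot all_order all_algebra.
From mathcomp Require Import all_classical all_reals all_analysis.
From mathcomp Require Import measurable_realfun complex.
From mathcomp Require Import ring lra zify.
Set Implicit Arguments. Unset Strict Implicit. Unset Printing Implicit Defensive.
Import Order.TTheory GRing.Theory Num.Theory.
Import numFieldNormedType.Exports.
Local Open Scope classical_set_scope.
Local Open Scope complex_scope.
Local Open Scope ring_scope.
Import ComplexField.Normc.
Local Notation Re := complex.Re.
Local Notation Im := complex.Im.

(** The convolution weights are [omega = gamma ((1 - X) A + (1 - X)^2 B / 2)], where
    [A] generates [a_m], the integral of [y^(-alpha)] over [[m, m + 1]], and [B]
    generates the (for [i = 2] shifted) sequence of the integrals of
    [(1 - 2 x) (m + x)^(-alpha)] over [[0, 1]].  Writing [a = e + b] with [b] this last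
    sequence, [e] decreases to [0] and [b] is convex and tends to [0], so [omega] is an
    l1-convergent combination with nonnegative coefficients of the polynomials
    [1 - X^N] and of those obtained from the tent sequences [(N - m)_+].  Each has
    nonnegative real part on the unit circle, by the Chebyshev recurrence for
    [cos (n t)], so the real part of the symbol is at least [c (1 - cos t)], [c > 0].
    Hence [z - omega] does not vanish on the closed disc when [Re z <= 0] and
    [z <> 0].  Instead of Wiener's lemma, which would invert it in l1, one writes
    [z - omega = (a - omega) - (a - z)] with [a > 0] large: the sup norm on the circle
    of polynomials close to [a - omega] is less than [|a - z|], and the l1 norm of the
    n-th power of a polynomial of degree [d] is at most [n d + 1] times the n-th power
    of its sup norm.  So some power of the convolution operator contracts, and a
    solution of the recursion, whose forcing by the starting values tends to [0],
    tends to [0] as well. *)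

(** * The l1 norm of complex polynomials *)

Section PolyL1.
Context {R : realType}.
Implicit Types (x y z : R[i]) (p q : {poly R[i]}).

Lemma normc_ge0 x : 0 <= normc x.
Proof. by case: x => a b; exact: sqrtr_ge0. Qed.

Lemma normcX x n : normc (x ^+ n) = normc x ^+ n.
Proof. by elim: n => [|n IH]; rewrite ?expr0 ?normc1// !exprS normcM IH. Qed.

Lemma normcB x y : normc (x - y) = normc (y - x).
Proof. by rewrite -normcN opprB. Qed.

Lemma normc_real (a : R) : normc a%:C = `|a|.
Proof. by rewrite /normc /= expr0n/= addr0 sqrtr_sqr. Qed.

Lemma normc_sum (I : Type) (r : seq I) (P : pred I) (F : I -> R[i]) :
  normc (\sum_(i <- r | P i) F i) <= \sum_(i <- r | P i) normc (F i).
Proof.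
elim/big_ind2: _ => [|x a y b xa yb|//]; first by rewrite normc0.
by rewrite (le_trans (le_normcD _ _))// lerD.
Qed.

Lemma sqr_normcE x : normc x ^+ 2 = Re x ^+ 2 + Im x ^+ 2.
Proof. by case: x => a b /=; rewrite sqr_sqrtr// addr_ge0 ?sqr_ge0. Qed.

Definition polyl1 p : R := \sum_(i < size p) normc p`_i.

Lemma polyl1_ge0 p : 0 <= polyl1 p.
Proof. by apply: sumr_ge0 => i _; exact: normc_ge0. Qed.

Lemma polyl1_wide p n : (size p <= n)%N -> polyl1 p = \sum_(i < n) normc p`_i.
Proof.
move=> pn; rewrite /polyl1 (big_ord_widen n (fun i => normc p`_i) pn).
rewrite [RHS](bigID (fun i : 'I_n => (i < size p)%N))/=.
rewrite [X in _ = _ + X]big1 ?addr0// => i; rewrite -leqNgt => pi.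
by rewrite nth_default ?normc0.
Qed.

Lemma polyl1D p q : polyl1 (p + q) <= polyl1 p + polyl1 q.
Proof.
set n := maxn (size p) (size q).
rewrite (@polyl1_wide (p + q) n) ?size_polyD// (@polyl1_wide p n) ?leq_maxl//.
rewrite (@polyl1_wide q n) ?leq_maxr// -big_split/=.
by apply: ler_sum => i _; rewrite coefD le_normcD.
Qed.

Lemma polyl10 : polyl1 0 = 0.
Proof. by rewrite /polyl1 size_poly0 big_ord0. Qed.

Lemma polyl11 : polyl1 1 = 1.
Proof. by rewrite /polyl1 size_poly1 big_ord1 coef1 normc1. Qed.

Lemma polyl1_sum (I : Type) (r : seq I) (P : pred I) (F : I -> {poly R[i]}) :
  polyl1 (\sum_(i <- r | P i) F i) <= \sum_(i <- r | P i) polyl1 (F i).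
Proof.
elim/big_ind2: _ => [|x a y b xa yb|//]; first by rewrite polyl10.
by rewrite (le_trans (polyl1D _ _))// lerD.
Qed.

Lemma polyl1Z x p : polyl1 (x *: p) = normc x * polyl1 p.
Proof.
rewrite (@polyl1_wide _ (size p)) ?size_scale_leq// /polyl1 mulr_sumr.
by apply: eq_bigr => i _; rewrite coefZ normcM.
Qed.

Lemma polyl1Mn p n : polyl1 (p *+ n) = polyl1 p *+ n.
Proof.
rewrite -scaler_nat polyl1Z -[(_%:R : R[i])](rmorph_nat (@real_complex R)).
by rewrite normc_real ger0_norm ?ler0n// mulr_natl.
Qed.

Lemma polyl1XnM n p : polyl1 ('X^n * p) <= polyl1 p.
Proof.
rewrite (@polyl1_wide _ (n + size p)) ?(leq_trans (size_polyMleq _ _))//; last first.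
  by rewrite size_polyXn.
rewrite big_split_ord/= big1 ?add0r; last first.
  by move=> i _; rewrite coefXnM ltn_ord normc0.
by apply: ler_sum => i _; rewrite coefXnM ltnNge leq_addr/= addKn.
Qed.

Lemma polyl1M p q : polyl1 (p * q) <= polyl1 p * polyl1 q.
Proof.
rewrite -[in leLHS](coefK p) poly_def mulr_suml (le_trans (polyl1_sum _ _ _))//.
rewrite [in leRHS]/polyl1 mulr_suml; apply: ler_sum => i _.
by rewrite -scalerAl polyl1Z ler_wpM2l ?normc_ge0 ?polyl1XnM.
Qed.

Lemma polyl1X p n : polyl1 (p ^+ n) <= polyl1 p ^+ n.
Proof.
elim: n => [|n IH]; first by rewrite !expr0 polyl11.
by rewrite !exprS (le_trans (polyl1M _ _))// ler_wpM2l ?polyl1_ge0.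
Qed.

(** Turns an l1 bound on a kernel [p] into a sup-norm bound for convolution with it, on each initial
    segment. *)
Lemma normc_coefM_le p q j (V : R) :
  (forall i, (i <= j)%N -> normc q`_i <= V) -> normc (p * q)`_j <= polyl1 p * V.
Proof.
move=> qV; rewrite coefM (le_trans (normc_sum _ _ _))//.
have V0 : 0 <= V by rewrite (le_trans _ (qV j _)) ?normc_ge0.
rewrite (@polyl1_wide _ (j.+1 + size p)) ?leq_addl// big_split_ord/= mulrDl.
rewrite -[leLHS]addr0 lerD//; last first.
  by rewrite mulr_ge0// sumr_ge0// => i _; exact: normc_ge0.
rewrite mulr_suml; apply: ler_sum => i _.
by rewrite normcM ler_wpM2l ?normc_ge0// qV// leq_subr.
Qed.

End PolyL1.

(** * Roots of unity and Cauchy estimates for coefficients *)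

Section RootsOfUnity.
Context {R : realType}.

Definition cis (t : R) : R[i] := cos t +i* sin t.

Lemma cisX t n : cis t ^+ n = cis (n%:R * t).
Proof.
elim: n => [|n IH]; first by rewrite mul0r /cis cos0 sin0.
by rewrite exprS IH -natr1 mulrDl mul1r /cis cosD sinD; simpc; congr (_ +i* _); ring.
Qed.

Lemma normc_cis t : normc (cis t) = 1.
Proof. by rewrite /normc /cis cos2Dsin2 sqrtr1. Qed.

Lemma unity_root_exists N : (0 < N)%N ->
  exists w : R[i], [/\ normc w = 1, w ^+ N = 1 &
    forall m, (0 < m < N)%N -> w ^+ m != 1].
Proof.
move=> N0; have N0' : 0 < N%:R :> R by rewrite ltr0n.
exists (cis (pi *+ 2 / N%:R)); split; first exact: normc_cis.
  by rewrite cisX mulrC divfK ?gt_eqF// /cis cos2pi sin2pi.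
move=> m /andP[m0 mN]; rewrite cisX; apply/negP => /eqP[cos1 _].
(* [y] is half the argument of [w ^+ m]: cos (2 y) = 1 would force sin y = 0, whereas 0 < y < pi. *)
set y := m%:R * (pi / N%:R) : R.
have yE : m%:R * (pi *+ 2 / N%:R) = y + y :> R by rewrite /y mulr2n; ring.
have : 0 < sin y.
  apply: sin_gt0_pi; apply/andP; split; first by rewrite mulr_gt0 ?ltr0n// divr_gt0// pi_gt0.
  by rewrite /y mulrCA -[ltRHS]mulr1 ltr_pM2l ?pi_gt0// ltr_pdivrMr// mul1r ltr_nat.
have := cos2Dsin2 y; move: cos1; rewrite yE cosD => cos1 cs s0.
suff : sin y ^+ 2 = 0 by move/eqP; rewrite sqrf_eq0 gt_eqF.
by move: cos1 cs; rewrite -!expr2 => cos1 cs; lra.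
Qed.

Lemma unity_root_sum (w : R[i]) N m : w ^+ N = 1 -> w ^+ m != 1 ->
  \sum_(k < N) (w ^+ k) ^+ m = 0.
Proof.
move=> wN wm; apply: (@mulfI _ (w ^+ m - 1)); first by rewrite subr_eq0.
rewrite mulr0; under eq_bigr do rewrite -exprM mulnC exprM.
by rewrite -subrX1 -exprM mulnC exprM wN expr1n subrr.
Qed.

(** Discrete Fourier inversion: the coefficient is an average of [p] over the roots of unity of
    order [size p], with weights of modulus 1. *)
Lemma normc_coef_le (p : {poly R[i]}) (B : R) j :
  (forall x, normc x = 1 -> normc p.[x] <= B) -> normc p`_j <= B.
Proof.
move=> pB; have [jp|jp] := ltnP j (size p); last first.
  by rewrite nth_default// normc0 (le_trans _ (pB 1 _)) ?normc_ge0 ?normc1.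
have N0 : (0 < size p)%N by case: (size p) jp.
have [w [w1 wN wm]] := unity_root_exists N0.
set N := size p in jp N0 wN wm.
(* The exponent [N - j] stands for [- j], as [w ^+ N = 1]. *)
have -> : p`_j = N%:R^-1 * \sum_(k < N) p.[w ^+ k] * (w ^+ k) ^+ (N - j).
  apply: (@mulfI _ N%:R); first by rewrite pnatr_eq0 -lt0n.
  rewrite mulrA mulfV ?mul1r ?pnatr_eq0 -?lt0n//.
  under [RHS]eq_bigr do rewrite horner_coef mulr_suml.
  rewrite exchange_big/= (bigD1 (Ordinal jp))//= [X in _ = _ + X]big1 ?addr0.
    under eq_bigr do rewrite -mulrA -exprD subnKC ?(ltnW jp)// -exprM mulnC exprM wN
      expr1n mulr1.
    by rewrite sumr_const card_ord mulr_natl.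
  move=> i ij; under eq_bigr do rewrite -mulrA -exprD.
  rewrite -mulr_sumr (@unity_root_sum _ N) ?mulr0//.
  have iN := ltn_ord i; have {}ij : (i : nat) != j by rewrite -(inj_eq val_inj) in ij.
  (* The exponent, reduced modulo [N], lies strictly between 0 and [N], so the sum over the roots
     vanishes. *)
  have [lt|ge] := ltnP (i + (N - j)) N; first by apply: wm; rewrite lt addn_gt0 subn_gt0 jp orbT.
  have ji : (j < i)%N.
    rewrite ltn_neqAle eq_sym ij leqNgt/=; apply: contraTN ge => ltij.
    by rewrite -ltnNge -[ltnRHS](subnKC (ltnW jp)) ltn_add2r.
  have -> : (i + (N - j) = (i - j) + N)%N by rewrite addnBAC 1?ltnW// addnBA// ltnW.
  by rewrite exprD wN mulr1; apply: wm; rewrite subn_gt0 ji (leq_ltn_trans (leq_subr _ _)).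
rewrite normcM normcV -[N%:R](rmorph_nat (@real_complex R)) normc_real ger0_norm ?ler0n//.
rewrite mulrC ler_pdivrMr ?ltr0n// (le_trans (normc_sum _ _ _))//.
apply: (@le_trans _ _ (\sum_(k < N) B)); last by rewrite sumr_const card_ord mulr_natr.
by apply: ler_sum => k _; rewrite normcM !normcX w1 !expr1n mulr1 pB// normcX w1 expr1n.
Qed.

(** There are at most [n * d + 1] coefficients in [p ^+ n], each bounded by [B ^+ n] through
    Cauchy's estimate. *)
Lemma polyl1_exp_le (p : {poly R[i]}) (B : R) d n : (size p <= d.+1)%N ->
  (forall x, normc x = 1 -> normc p.[x] <= B) ->
  polyl1 (p ^+ n) <= (n * d).+1%:R * B ^+ n.
Proof.
move=> pd pB; rewrite (@polyl1_wide _ _ (n * d).+1); last first.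
  rewrite (leq_trans (size_poly_exp_leq _ _))// ltnS mulnC leq_mul2l.
  by apply/orP; right; lia.
apply: (@le_trans _ _ (\sum_(i < (n * d).+1) B ^+ n)); last first.
  by rewrite sumr_const card_ord mulr_natl.
apply: ler_sum => i _; apply: normc_coef_le => x x1.
by rewrite horner_exp normcX lerXn2r ?nnegrE ?normc_ge0 ?pB// (le_trans (normc_ge0 _) (pB _ x1)).
Qed.

(** Binomial expansion, with powers of [p] measured through the sup norm and powers of the
    perturbation [e] through the l1 norm. *)
Lemma polyl1_exprD_le (p e : {poly R[i]}) (B h : R) d n : (size p <= d.+1)%N ->
  (forall x, normc x = 1 -> normc p.[x] <= B) -> polyl1 e <= h ->
  polyl1 ((p + e) ^+ n) <= (n * d).+1%:R * (B + h) ^+ n.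
Proof.
move=> pd pB eh.
have B0 : 0 <= B by rewrite (le_trans _ (pB 1 _)) ?normc_ge0 ?normc1.
have h0 : 0 <= h by rewrite (le_trans (polyl1_ge0 e)).
rewrite !exprDn (le_trans (polyl1_sum _ _ _))// mulr_sumr; apply: ler_sum => i _.
rewrite polyl1Mn mulrnAr lerMn2r; apply/orP; right.
rewrite (le_trans (polyl1M _ _))// mulrA ler_pM ?polyl1_ge0//.
  rewrite (le_trans (polyl1_exp_le _ pd pB))// ler_wpM2r ?exprn_ge0// ler_nat ltnS.
  by rewrite leq_mul2r leq_subr orbT.
by rewrite (le_trans (polyl1X _ _))// lerXn2r ?nnegrE ?polyl1_ge0.
Qed.

End RootsOfUnity.

(** * Convolution equations *)

Section Convolution.
Context {R : realType}.
Implicit Types (K u v g h : nat -> R[i]).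

Definition conv K u (n : nat) : R[i] := \sum_(j < n.+1) K (n - j)%N * u j.

Definition null u := forall e : R, 0 < e ->
  exists N, forall n, (N <= n)%N -> normc (u n) <= e.

(** Cauchy form of absolute summability. *)
Definition summable_tail K := forall e : R, 0 < e ->
  exists M, forall n, \sum_(M <= i < n) normc (K i) <= e.

Lemma convE K u n : conv K u n = \sum_(0 <= i < n.+1) K i * u (n - i)%N.
Proof.
rewrite /conv big_mkord (reindex_inj rev_ord_inj)/=; apply: eq_bigr => i _.
by rewrite subSS subKn// -ltnS.
Qed.

Lemma convB K u v n : conv K (fun j => u j - v j) n = conv K u n - conv K v n.
Proof. by rewrite /conv -sumrB; apply: eq_bigr => i _; rewrite mulrBr. Qed.

Lemma convD K u v n : conv K (fun j => u j + v j) n = conv K u n + conv K v n.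
Proof. by rewrite /conv -big_split; apply: eq_bigr => i _; rewrite mulrDr. Qed.

Lemma convZ K (a : R[i]) v n : conv K (fun j => a * v j) n = a * conv K v n.
Proof. by rewrite /conv mulr_sumr; apply: eq_bigr => i _; rewrite mulrCA. Qed.

Lemma eq_conv K u v n : (forall j, (j <= n)%N -> u j = v j) -> conv K u n = conv K v n.
Proof. by move=> uv; apply: eq_bigr => i _; rewrite uv// -ltnS. Qed.

Lemma iter_convD K m u v n :
  iter m (conv K) (fun j => u j + v j) n = iter m (conv K) u n + iter m (conv K) v n.
Proof. by elim: m n => // m IH n /=; rewrite -convD; apply: eq_conv => j _. Qed.

Lemma iter_convB K m u v n :
  iter m (conv K) (fun j => u j - v j) n = iter m (conv K) u n - iter m (conv K) v n.
Proof. by elim: m n => // m IH n /=; rewrite -convB; apply: eq_conv => j _. Qed.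

Lemma iter_convZ K m (a : R[i]) v n :
  iter m (conv K) (fun j => a * v j) n = a * iter m (conv K) v n.
Proof. by elim: m n => // m IH n /=; rewrite -convZ; apply: eq_conv => j _. Qed.

Lemma eq_iter_conv K m u v n : (forall j, (j <= n)%N -> u j = v j) ->
  iter m (conv K) u n = iter m (conv K) v n.
Proof.
elim: m n => [|m IH] n uv/=; first exact: uv.
by apply: eq_conv => j jn; apply: IH => i ij; apply: uv; exact: leq_trans jn.
Qed.

(** Coefficients up to [N] of a product see only the factors up to [N], so truncation turns iterated
    convolution into multiplication by a power of a polynomial. *)
Lemma iter_conv_poly K m v N n : (n <= N)%N ->
  iter m (conv K) v n = ((\poly_(i < N.+1) K i) ^+ m * \poly_(i < N.+1) v i)`_n.
Proof.
elim: m n => [|m IH] n nN; first by rewrite expr0 mul1r coef_poly ltnS nN.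
rewrite iterS exprS -mulrA coefMr; apply: eq_bigr => i _.
have iN : (i <= N)%N by rewrite (leq_trans _ nN)// -ltnS.
by rewrite IH// coef_poly ltnS (leq_trans (leq_subr _ _) nN).
Qed.

Lemma null_bounded g : null g -> exists2 G : R, 0 < G & forall n, normc (g n) <= G.
Proof.
move=> /(_ 1 ltr01)[N gN]; exists (1 + \sum_(i < N) normc (g i)).
  by rewrite ltr_pwDl// sumr_ge0// => i _; exact: normc_ge0.
move=> n; have [Nn|nN] := leqP N n.
  by rewrite (le_trans (gN _ Nn))// lerDl sumr_ge0// => i _; exact: normc_ge0.
rewrite (bigD1 (Ordinal nN))//= addrCA lerDl addr_ge0// sumr_ge0// => i _.
exact: normc_ge0.
Qed.

(** Split the kernel at [M]: its head meets only late, hence small, values of [g], and its small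
    tail meets bounded ones. *)
Lemma conv_null K g : summable_tail K -> null g -> null (conv K g).
Proof.
move=> tK ng e e0; have [G G0 gG] := null_bounded ng.
have [M KM] := tK (e / 2 / G) (divr_gt0 (divr_gt0 e0 (ltr0Sn _ _)) G0).
set L := 1 + \sum_(0 <= i < M) normc (K i).
have L0 : 0 < L by rewrite ltr_pwDl// sumr_ge0// => i _; exact: normc_ge0.
have [N gN] := ng (e / 2 / L) (divr_gt0 (divr_gt0 e0 (ltr0Sn _ _)) L0).
exists (N + M)%N => n Nn; rewrite convE (le_trans (normc_sum _ _ _))//.
rewrite (@big_cat_nat _ _ _ M)//=; last by rewrite ltnW// ltnS (leq_trans _ Nn)// leq_addl.
have -> : e = L * (e / 2 / L) + (e / 2 / G) * G.
  by field; rewrite !gt_eqF.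
apply: lerD.
- apply: (@le_trans _ _ (\sum_(0 <= i < M) normc (K i) * (e / 2 / L))).
    apply: ler_sum_nat => i /andP[_ iM]; rewrite normcM ler_wpM2l ?normc_ge0// gN//.
    by rewrite leq_subRL; lia.
  rewrite -mulr_suml ler_wpM2r ?lerDr// ltW// !divr_gt0//.
- apply: (@le_trans _ _ (\sum_(M <= i < n.+1) normc (K i) * G)).
    by apply: ler_sum_nat => i _; rewrite normcM ler_wpM2l ?normc_ge0.
  by rewrite -mulr_suml ler_wpM2r ?(ltW G0).
Qed.

Lemma iter_conv_null K m g : summable_tail K -> null g -> null (iter m (conv K) g).
Proof. by move=> tK ng; elim: m => //= m IH; exact: conv_null. Qed.

Lemma nullD g h : null g -> null h -> null (fun n => g n + h n).
Proof.
move=> ng nh e e0; have e20 : 0 < e / 2 by rewrite divr_gt0.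
have [[N gN] [M hM]] := (ng _ e20, nh _ e20); exists (N + M)%N => n Nn.
rewrite (le_trans (le_normcD _ _))// [leRHS](splitr e) lerD// ?gN ?hM//.
  by rewrite (leq_trans _ Nn)// leq_addr.
by rewrite (leq_trans _ Nn)// leq_addl.
Qed.

Lemma nullZ (a : R[i]) g : null g -> null (fun n => a * g n).
Proof.
move=> ng e e0; have a0 := normc_ge0 a.
have a1 : 0 < normc a + 1 by rewrite ltr_wpDl.
have [N gN] := ng _ (divr_gt0 e0 a1); exists N => n /gN gn.
rewrite normcM (le_trans (ler_wpM2l a0 gn))//.
by rewrite mulrA ler_pdivrMr// mulrC ler_pM2l// lerDl.
Qed.

Lemma eq_null g h N : (forall n, (N <= n)%N -> g n = h n) -> null g -> null h.
Proof.
move=> gh ng e /ng[M gM]; exists (N + M)%N => n Nn.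
by rewrite -gh ?gM// (leq_trans _ Nn)// ?leq_addr ?leq_addl.
Qed.

(** The equation is substituted into itself; the accumulated forcing stays null because convolution
    preserves null sequences. *)
Lemma iterate_equation K (c : R[i]) u g m : summable_tail K -> null g ->
  (forall j, c * u j = conv K u j - g j) ->
  exists2 h, null h & forall j, c ^+ m * u j = iter m (conv K) u j - h j.
Proof.
move=> tK ng ueq; elim: m => [|m [h nh IH]].
  by exists (fun=> 0) => [e e0|j]; [exists 0%N => n _; rewrite normc0 ltW|rewrite mul1r subr0].
exists (fun j => iter m (conv K) g j + c * h j).
  by apply: nullD; [exact: iter_conv_null|exact: nullZ].
move=> j; rewrite exprS -mulrA IH mulrBr -iter_convZ.
have -> : iter m (conv K) (fun j => c * u j) j = iter m (conv K) (fun j => conv K u j - g j) j.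
  by apply: eq_iter_conv => i _.
by rewrite iter_convB -iterSr/= opprD addrA.
Qed.

(* A power of the convolution operator that contracts the sup norm on every
   initial segment already forces decay: split [u] at a large index and use that
   convolution preserves null sequences. *)
Lemma contraction_null K (c : R[i]) (Q : R) m u g : summable_tail K -> null g ->
  (forall j, c * u j = conv K u j - g j) ->
  (forall v j (V : R), (forall i, (i <= j)%N -> normc (v i) <= V) ->
     normc (iter m (conv K) v j) <= Q * V) ->
  Q < normc c ^+ m -> null u.
Proof.
move=> tK ng ueq KQ Qc; have [h nh uh] := iterate_equation m tK ng ueq.
set C := normc c ^+ m in Qc.
have Q0 : 0 <= Q.
  rewrite -[leRHS]mulr1 (le_trans (normc_ge0 _) (KQ (fun=> 1) 0%N 1 _))//.
  by move=> i _; rewrite normc1.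
have C0 : 0 < C by exact: le_lt_trans Qc.
have uC j : C * normc (u j) <= normc (iter m (conv K) u j) + normc (h j).
  by rewrite /C -normcX -normcM uh (le_trans (le_normcD _ _))// normcN.
have [G G0 hG] := null_bounded nh.
have CQ : 0 < C - Q by rewrite subr_gt0.
(* At the index [i <= N] where |u| is largest, C |u i| <= Q |u i| + G, a bound that does not depend
   on [N]. *)
have [U U0 uU] : exists2 U : R, 0 < U & forall n, normc (u n) <= U.
  exists (G / (C - Q)); first exact: divr_gt0.
  move=> N; pose F (i : 'I_N.+1) := normc (u i).
  case: (@Order.TotalTheory.arg_maxP _ R 'I_N.+1 ord0 xpredT F isT) => i _ /= uimax.
  apply: (@le_trans _ _ (normc (u i))); first exact: (uimax ord_max isT).
  rewrite ler_pdivlMr// mulrBr lerBlDr mulrC (le_trans (uC i))// addrC lerD ?hG//.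
  rewrite [leRHS]mulrC; apply: KQ => l li.
  have lN : (l < N.+1)%N by rewrite (leq_ltn_trans li).
  exact: (uimax (Ordinal lN) isT).
(* [r * C] is the midpoint of [Q] and [C]; the slack (C - Q) / 2 above [Q] is shared equally by the
   forcing and the early part [u1]. *)
pose r := (C + Q) / 2 / C.
have r0 : 0 < r by rewrite !divr_gt0// ltr_wpDr.
have r1 : r < 1 by rewrite ltr_pdivrMr// mul1r ltr_pdivrMr//; lra.
(* An eventual bound [b] improves to [r * b]: [u1] has finite support, so its image is null, and
   [u2] is bounded by [b] everywhere. *)
have step b : 0 < b -> (exists N, forall n, (N <= n)%N -> normc (u n) <= b) ->
    exists N, forall n, (N <= n)%N -> normc (u n) <= r * b.
  move=> b0 [N uN].
  pose u1 j := if (j < N)%N then u j else 0; pose u2 j := if (j < N)%N then 0 else u j.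
  have n1 : null u1.
    by move=> e e0; exists N => n Nn; rewrite /u1 ltnNge Nn normc0 ltW.
  have := iter_conv_null m tK n1; have d0 : 0 < (C - Q) / 4 * b by rewrite mulr_gt0// divr_gt0.
  move=> /(_ _ d0)[N1 I1]; have [N2 H2] := nh _ d0.
  exists (N1 + N2)%N => n Nn.
  rewrite -(ler_pM2l C0) (le_trans (uC n))//.
  have -> : iter m (conv K) u n = iter m (conv K) u1 n + iter m (conv K) u2 n.
    rewrite -iter_convD; apply: eq_iter_conv => j _; rewrite /u1 /u2.
    by case: ifP; rewrite ?addr0 ?add0r.
  have i1 : normc (iter m (conv K) u1 n) <= (C - Q) / 4 * b.
    by apply: I1; rewrite (leq_trans _ Nn)// leq_addr.
  have i2 : normc (h n) <= (C - Q) / 4 * b.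
    by apply: H2; rewrite (leq_trans _ Nn)// leq_addl.
  have i3 : normc (iter m (conv K) u2 n) <= Q * b.
    apply: KQ => i _; rewrite /u2; case: ltnP => Ni; last exact: uN.
    by rewrite normc0 ltW.
  have i4 := le_normcD (iter m (conv K) u1 n) (iter m (conv K) u2 n).
  have -> : C * (r * b) = (C + Q) / 2 * b by rewrite /r; field; rewrite gt_eqF.
  lra.
have pow k : exists N, forall n, (N <= n)%N -> normc (u n) <= r ^+ k * U.
  elim: k => [|k IH]; first by exists 0%N => n _; rewrite expr0 mul1r.
  have [|N uN] := step _ _ IH; first by rewrite mulr_gt0// exprn_gt0.
  by exists N => n /uN; rewrite exprS mulrA.
move=> e e0; have : (fun k => r ^+ k) @ \oo --> (0 : R).
  by apply: cvg_expr; rewrite gtr0_norm.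
move=> /cvgrPdist_le /(_ (e / U) (divr_gt0 e0 U0))[k _ /(_ k (leqnn k))].
rewrite /= sub0r normrN gtr0_norm ?exprn_gt0// => rk.
have [N uN] := pow k; exists N => n /uN /le_trans; apply.
by rewrite -ler_pdivlMr.
Qed.

End Convolution.

(** * Stability from positivity of the symbol *)

Section Wiener.
Context {R : realType}.

(** Write b / a = s * s. By Bernoulli one factor [s ^+ m] exceeds a constant [k] and the other
    exceeds 1 + m h; [k] is chosen so that k (1 + m h) beats m d + 1. *)
Lemma linear_lt_exp (a b : R) d : 0 <= a < b ->
  exists n, (n * d).+1%:R * a ^+ n < b ^+ n.
Proof.
move=> /andP[a0 ab]; have b0 : 0 < b by exact: le_lt_trans ab.
have [->|aN0] := eqVneq a 0.
  by exists 1%N; rewrite expr1 mulr0 expr1.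
have {a0}a0 : 0 < a by rewrite lt_def aN0.
pose t := b / a; have t1 : 1 < t by rewrite ltr_pdivlMr// mul1r.
pose s := Num.sqrt t; have s1 : 1 < s by rewrite -sqrtr1 ltr_sqrt// (lt_trans _ t1).
have ss : s * s = t by rewrite -expr2 sqr_sqrtr// ltW// (lt_trans _ t1).
pose h := s - 1; have h0 : 0 < h by rewrite subr_gt0.
have bern n : 1 + n%:R * h <= s ^+ n.
  elim: n => [|n IH]; first by rewrite mul0r addr0 expr0.
  rewrite exprS -natr1 (le_trans _ (ler_wpM2l (ltW (lt_trans ltr01 s1)) IH))//.
  have -> : s = 1 + h by rewrite /h addrC subrK.
  have : 0 <= n%:R * h * h by rewrite !mulr_ge0 ?ler0n ?(ltW h0).
  lra.
have [k kd] : exists k : nat, d%:R / h + 1 < k%:R.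
  by exists (Num.truncn (d%:R / h + 1)).+1; apply: Num.Theory.truncnS_gt.
have [m mk] : exists m : nat, k%:R / h < m%:R.
  by exists (Num.truncn (k%:R / h)).+1; apply: Num.Theory.truncnS_gt.
exists m; have bE : b = a * t by rewrite /t mulrC divfK ?gt_eqF.
rewrite bE exprMn mulrC ltr_pM2l ?exprn_gt0// -ss exprMn.
have s0 := exprn_gt0 m (lt_trans ltr01 s1).
apply: (@lt_le_trans _ _ (k%:R * s ^+ m)); last first.
  rewrite ler_pM2r// (le_trans _ (bern m))//.
  by move: mk; rewrite ltr_pdivrMr// => /ltW mk; rewrite ler_wpDl.
apply: (@lt_le_trans _ _ (k%:R * (1 + m%:R * h))); last by rewrite ler_wpM2l.
have dh : d%:R < (k%:R - 1) * h by rewrite -ltr_pdivrMr//; move: kd; lra.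
have k1 : 1 < k%:R :> R by rewrite (le_lt_trans _ kd)// lerDr divr_ge0// ltW.
rewrite -natr1 natrM.
have := ler_wpM2l (ler0n R m) (ltW dh); have : 0 <= m%:R * h by rewrite mulr_ge0// ltW.
lra.
Qed.

Definition polyRC (p : {poly R}) : {poly R[i]} := map_poly (real_complex R) p.

Lemma normc_horner_le (p : {poly R[i]}) x : normc x = 1 -> normc p.[x] <= polyl1 p.
Proof.
move=> x1; rewrite horner_coef (le_trans (normc_sum _ _ _))// ler_sum// => i _.
by rewrite normcM normcX x1 expr1n mulr1.
Qed.

Lemma sqr_normc_sub1 (x : R[i]) : normc x = 1 -> normc (1 - x) ^+ 2 = 2 * (1 - Re x).
Proof.
move=> x1; have := sqr_normcE x; rewrite x1 expr1n sqr_normcE.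
by case: x {x1} => a b /= ab; lra.
Qed.

Lemma sqr_normc_shift (a : R) (x : R[i]) :
  normc (a%:C - x) ^+ 2 = a ^+ 2 - 2 * a * Re x + normc x ^+ 2.
Proof. by rewrite !sqr_normcE; case: x => b c /=; ring. Qed.

(* A version of Wiener's lemma for symbols approximated in l1 by polynomials with
   positive real part on the circle.  The disc of large radius centred at [a > 0]
   contains the range of the symbol but not [z], so the Neumann series of
   [(a - z) - (a - omega)] converges in l1: the l1 norm of the n-th power of a
   polynomial is at most a linear factor times the n-th power of its sup norm. *)
Theorem wiener_stability (omega : nat -> R) (c : R) (z : R[i]) (u g : nat -> R[i]) :
  0 < c ->
  (forall eta : R, 0 < eta -> exists p : {poly R},
    [/\ forall n, \sum_(i < n) `|omega i - p`_i| <= eta,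
        forall x, normc x = 1 -> c * (1 - Re x) <= Re (polyRC p).[x] &
        p.[1] = 0]) ->
  z != 0 -> Re z <= 0 -> null g ->
  (forall n, conv (fun m => (omega m)%:C) u n = z * u n - g n) -> null u.
Proof.
move=> c0 approx z0 rez ng ueq.
set r := normc z; have r0 : 0 < r.
  by rewrite lt_def normc_ge0 andbT; apply: contra z0 => /eqP/eq0_normc->.
have r8 : 0 < r / 8 by rewrite divr_gt0.
(* A fixed coarse approximant. Vanishing at 1, it satisfies |p0(x)| <= L |1 - x| on the circle, with
   [L] independent of the finer [p] chosen later. *)
have [p0 [ap0 _ p01]] := approx _ r8.
have [q pq] : exists q, p0 = q * ('X - 1%:P) by apply/factor_theorem/eqP.
pose L := polyl1 (polyRC q) + 1.
have L0 : 0 < L by rewrite ltr_wpDl ?polyl1_ge0.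
have p0L x : normc x = 1 -> normc (polyRC p0).[x] <= L * normc (1 - x).
  move=> x1; rewrite pq /polyRC rmorphM/= map_polyXsubC hornerM !hornerE normcM normcB.
  by rewrite ler_wpM2r ?normc_ge0// (le_trans (normc_horner_le _ x1))// lerDl.
have pdiff (p : {poly R}) (e : R) : (forall n, \sum_(i < n) `|omega i - p`_i| <= e) ->
    forall x, normc x = 1 -> normc ((polyRC p).[x] - (polyRC p0).[x]) <= e + r / 8.
  move=> pe x x1; rewrite -hornerN -hornerD (le_trans (normc_horner_le _ x1))//.
  rewrite /polyl1; set n := size _; rewrite (le_trans _ (lerD (pe n) (ap0 n)))//.
  rewrite -big_split/=; apply: ler_sum => i _.
  rewrite coefB !coef_map -rmorphB normc_real.
  rewrite (_ : p`_i - p0`_i = - (omega i - p`_i) + (omega i - p0`_i)); last by ring.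
  by rewrite (le_trans (ler_normD _ _))// normrN.
pose B := polyl1 (polyRC p0) + r.
have B0 : 0 < B by rewrite ltr_wpDl ?polyl1_ge0.
(* At distance more than r / (4 L) from 1, [kap] is a lower bound for [1 - Re x], since |1 - x|^2 =
   2 (1 - Re x). The choice of [a] makes 2 a c kap = B^2. *)
pose kap := (r / (4 * L)) ^+ 2 / 2.
have kap0 : 0 < kap by rewrite divr_gt0// exprn_gt0// divr_gt0// mulr_gt0.
pose a := B ^+ 2 / (2 * c * kap).
have a0 : 0 < a by apply: divr_gt0; [exact: exprn_gt0|apply: mulr_gt0 => //; exact: mulr_gt0].
(* [S] will bound [a - p] on the circle; as Re z <= 0, |a - z|^2 >= a^2 + r^2 > S^2. *)
pose S := Num.sqrt (a ^+ 2 + r ^+ 2 / 4).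
have S2 : S ^+ 2 = a ^+ 2 + r ^+ 2 / 4 by rewrite sqr_sqrtr// addr_ge0 ?divr_ge0 ?sqr_ge0.
have S0 : 0 <= S by exact: sqrtr_ge0.
pose zt := a%:C - z.
have Szt : S < normc zt.
  rewrite -(@ltr_pXn2r _ 2) ?nnegrE ?normc_ge0// S2 sqr_normc_shift -/r.
  have : 0 <= a * - Re z by rewrite mulr_ge0 ?oppr_ge0// ltW.
  have : 0 < r ^+ 2 by rewrite exprn_gt0.
  lra.
(* The first bound keeps [p] within r / 4 of [p0] on the circle, the second gives S + eta < |a -
   z|. *)
pose eta := Num.min (r / 8) ((normc zt - S) / 2).
have eta0 : 0 < eta by rewrite lt_min r8/= divr_gt0// subr_gt0.
have eta8 : eta <= r / 8 by rewrite ge_min lexx.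
have etaS : S + eta < normc zt.
  have : eta <= (normc zt - S) / 2 by rewrite ge_min lexx orbT.
  lra.
have [p [ap pc _]] := approx _ eta0.
have pS x : normc x = 1 -> normc (a%:C%:P - polyRC p).[x] <= S.
  move=> x1; rewrite hornerD hornerN hornerC.
  rewrite -(@ler_pXn2r _ 2) ?nnegrE ?normc_ge0// S2 sqr_normc_shift.
  set y := (polyRC p).[x].
  have yc : c * (1 - Re x) <= Re y by exact: pc.
  have yd := pdiff _ _ ap x x1; rewrite -/y in yd.
  have ytri := le_normcD (y - (polyRC p0).[x]) (polyRC p0).[x].
  rewrite subrK in ytri.
  have x10 := sqr_normc_sub1 x1; have x1ge0 := normc_ge0 (1 - x).
  have rex : 0 <= 1 - Re x by have := sqr_ge0 (normc (1 - x)); lra.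
  have Rey0 : 0 <= Re y by rewrite (le_trans _ yc)// mulr_ge0// ltW.
  (* Near 1, |y| <= r / 4 + r / 4 and Re y >= 0 suffice; far from 1, the term 2 a Re y >= B^2
     outweighs |y|^2. *)
  have [near|far] := leP (normc (1 - x)) (r / (4 * L)).
    have : L * normc (1 - x) <= r / 4.
      have -> : r / 4 = L * (r / (4 * L)) by field; rewrite gt_eqF.
      by rewrite ler_pM2l.
    move=> Lx; have y2 : normc y <= r / 2 by have := p0L x x1; lra.
    have : normc y ^+ 2 <= (r / 2) ^+ 2 by rewrite ler_pXn2r// nnegrE ?normc_ge0// divr_ge0// ltW.
    have := mulr_ge0 (ltW a0) Rey0; lra.
  have kx : kap <= 1 - Re x.
    have : (r / (4 * L)) ^+ 2 <= normc (1 - x) ^+ 2.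
      by rewrite ler_pXn2r ?nnegrE ?(ltW far)// divr_ge0 ?mulr_ge0 ?normc_ge0// ltW.
    by rewrite x10 /kap => /= ?; lra.
  have yB : normc y <= B.
    by have := normc_horner_le (polyRC p0) x1; rewrite /B; lra.
  have yB2 : normc y ^+ 2 <= B ^+ 2 by rewrite ler_pXn2r// nnegrE ?normc_ge0// ltW.
  have : B ^+ 2 = 2 * a * (c * kap) by rewrite /a; field; rewrite !gt_eqF.
  have : 2 * a * (c * kap) <= 2 * a * Re y.
    by rewrite ler_wpM2l// ?(le_trans _ yc)// ?ler_wpM2l ?(ltW c0)// mulr_ge0 ?(ltW a0).
  have := sqr_ge0 r; lra.
pose K (m : nat) : R[i] := ((m == 0)%:R * a - omega m)%:C.
have KE j v : conv K v j = a%:C * v j - conv (fun m => (omega m)%:C) v j.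
  rewrite /conv /K; under eq_bigr do rewrite rmorphB mulrBl.
  rewrite sumrB big_ord_recr/= subnn eqxx mul1r big1 ?add0r// => i _.
  by rewrite subn_eq0 leqNgt ltn_ord mul0r mul0r.
have tK : summable_tail K.
  move=> e e0; have [p' [ap' _ _]] := approx _ e0; exists (size p').+1 => n.
  have [np|pn] := leqP n (size p').+1; first by rewrite big_geq// ltW.
  rewrite (le_trans _ (ap' n))//.
  rewrite -(big_mkord xpredT (fun i => `|omega i - p'`_i|)).
  rewrite [leRHS](@big_cat_nat _ _ _ (size p').+1)// ?(ltnW pn)//.
  rewrite -[leLHS]add0r lerD ?sumr_ge0//; apply: ler_sum_nat => i /andP[pi _].
  rewrite /K normc_real nth_default 1?ltnW// -(subnKC pi) addSn/= mul0r sub0r subr0.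
  by rewrite normrN.
have [n nS] : exists n, (n * (size p).+1).+1%:R * (S + eta) ^+ n < normc zt ^+ n.
  by apply: linear_lt_exp; rewrite etaS addr_ge0 ?(ltW eta0).
apply: (@contraction_null _ K zt _ n u g tK ng _ _ nS).
  by move=> j; rewrite KE ueq /zt; ring.
move=> v j V vV.
(* Truncation at [N] keeps everything up to [j] and all of [p]; [E] then has, up to sign, the
   coefficients of [omega - p], of l1 norm at most [eta]. *)
pose N := (j + size p)%N; rewrite (@iter_conv_poly _ _ _ _ N) ?leq_addr//.
apply: le_trans (normc_coefM_le _ (V := V) _) _.
  by move=> i ij; rewrite coef_poly; case: ifP => _; [exact: vV|
    rewrite normc0 (le_trans (normc_ge0 _) (vV j _))].
have V0 : 0 <= V by rewrite (le_trans (normc_ge0 _) (vV j _)).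
rewrite ler_wpM2r//.
set E := (\poly_(i < N.+1) K i - (a%:C%:P - polyRC p)).
have -> : \poly_(i < N.+1) K i = (a%:C%:P - polyRC p) + E by rewrite /E addrC subrK.
apply: polyl1_exprD_le => //.
  rewrite (leq_trans (size_polyD _ _))// geq_max (leq_trans (size_polyC_leq1 _))//=.
  by rewrite size_polyN (leq_trans (size_poly _ _))// ltnW.
rewrite (@polyl1_wide _ _ N.+1); last first.
  rewrite (leq_trans (size_polyD _ _))// geq_max size_poly/= size_polyN.
  rewrite (leq_trans (size_polyD _ _))// geq_max (leq_trans (size_polyC_leq1 _))//=.
  by rewrite size_polyN (leq_trans (size_poly _ _))// /N ltnW// ltnS leq_addl.
apply: le_trans (ap N.+1); apply: ler_sum => i _.
rewrite !coefB coef_poly ltn_ord coefC coef_map/= /K.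
have -> : (if (i : nat) == 0%N then a%:C else 0) = ((i == 0 :> nat)%:R * a)%:C.
  by case: eqP => _; rewrite ?mul1r ?mul0r.
rewrite -!rmorphB normc_real.
by rewrite (_ : _ - _ = - (omega i - p`_i)) ?normrN//; ring.
Qed.

End Wiener.

(** * Positivity on the unit circle *)

Section Chebyshev.
Context {R : realType}.
Implicit Types (p q : {poly R}) (x : R[i]).

Definition reval x p : R := Re (polyRC p).[x].

Lemma revalD x p q : reval x (p + q) = reval x p + reval x q.
Proof. by rewrite /reval /polyRC rmorphD hornerD; case: (_.[x]) (_.[x]) => a b [] c d. Qed.

Lemma revalZ x (a : R) p : reval x (a *: p) = a * reval x p.
Proof.
rewrite /reval /polyRC linearZ/= hornerZ; case: (_.[x]) => b c /=.
by rewrite mul0r subr0.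
Qed.

Lemma revalN x p : reval x (- p) = - reval x p.
Proof. by rewrite -scaleN1r revalZ mulN1r. Qed.

Lemma reval_sum x (I : Type) (r : seq I) (P : pred I) (F : I -> {poly R}) :
  reval x (\sum_(i <- r | P i) F i) = \sum_(i <- r | P i) reval x (F i).
Proof.
apply: (big_morph (reval x) (revalD x)).
by rewrite /reval /polyRC rmorph0 horner0.
Qed.

Lemma revalXn x n : reval x 'X^n = Re (x ^+ n).
Proof. by rewrite /reval /polyRC map_polyXn hornerXn. Qed.

Lemma reval1 x : reval x 1 = 1.
Proof. by rewrite -(expr0 'X) revalXn. Qed.

Lemma revalX x : reval x 'X = Re x.
Proof. by rewrite -(expr1 'X) revalXn expr1. Qed.

Section OnCircle.
Variable x : R[i].
Hypothesis x1 : normc x = 1.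
Local Notation c := (Re x).
Local Notation cn n := (Re (x ^+ n)).
Local Notation sn n := (Im (x ^+ n)).

Lemma circle_eq (y : R[i]) : normc y = 1 -> Re y ^+ 2 + Im y ^+ 2 = 1.
Proof. by move=> y1; rewrite -sqr_normcE y1 expr1n. Qed.

Lemma circle_pow n : cn n ^+ 2 + sn n ^+ 2 = 1.
Proof. by apply: circle_eq; rewrite normcX x1 expr1n. Qed.

Lemma Re_le1 : c <= 1.
Proof.
have := circle_eq x1; rewrite leNgt => cs; apply/negP => c1.
have : 1 < c ^+ 2 by rewrite exprn_egt1.
have := sqr_ge0 (Im x); lra.
Qed.

Lemma cn_le1 n : cn n <= 1.
Proof.
have := circle_pow n; rewrite leNgt => cs; apply/negP => c1.
have : 1 < cn n ^+ 2 by rewrite exprn_egt1.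
have := sqr_ge0 (sn n); lra.
Qed.

Lemma cnS n : cn n.+1 = c * cn n - Im x * sn n.
Proof. by rewrite exprS; case: x (x ^+ n) => a b []. Qed.

Lemma snS n : sn n.+1 = c * sn n + Im x * cn n.
Proof. by rewrite exprS; case: x (x ^+ n) => a b [] d e /=; ring. Qed.

Lemma chebyshev n : cn n.+2 = 2 * c * cn n.+1 - cn n.
Proof.
have xx : x ^+ 2 = (2 * c)%:C * x - 1.
  have := circle_eq x1; case: x => a b /= ab; rewrite expr2.
  by apply/eqP; rewrite eq_complex/=; apply/andP; split; apply/eqP; lra.
rewrite -addn2 exprD xx mulrBr mulr1 mulrCA -exprSr.
by case: (x ^+ n.+1) (x ^+ n) => a b [] d e /=; ring.
Qed.

(** On the circle (1 - x)^2 = - 2 (1 - Re x) x, so a second difference acts as a real factor times a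
    shift. *)
Lemma reval_sqr_1subX p : reval x ((1 - 'X) ^+ 2 * p) = - (2 * (1 - c)) * reval x ('X * p).
Proof.
rewrite /reval /polyRC !rmorphM/= !rmorphB/= rmorph1 map_polyX !hornerM !hornerE.
have -> : (1 - x) * (1 - x) = (- (2 * (1 - c)))%:C * x.
  have := circle_eq x1; case: x => a b /= ab.
  by apply/eqP; rewrite eq_complex/=; apply/andP; split; apply/eqP; lra.
by rewrite -mulrA; case: (x * _) => a b /=; ring.
Qed.

Definition geom n : {poly R} := \sum_(l < n) 'X^l.

(** The tent: its coefficient of X^m is (N - m)_+. *)
Definition hat N : {poly R} := \sum_(l < N) geom l.+1.

Lemma hatS N : hat N.+1 = hat N + geom N.+1.
Proof. by rewrite /hat big_ord_recr. Qed.

Lemma reval_1subX_geom n : reval x ((1 - 'X) * geom n) = 1 - cn n.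
Proof.
rewrite /geom -opprB mulNr -subrX1 opprB revalD revalN revalXn.
by rewrite reval1.
Qed.

Lemma reval_1subX_hat N : reval x ((1 - 'X) * hat N) = \sum_(l < N) (1 - cn l.+1).
Proof.
by rewrite /hat mulr_sumr reval_sum; apply: eq_bigr => l _; rewrite reval_1subX_geom.
Qed.

Lemma reval_X_geom n : 2 * (1 - c) * reval x ('X * geom n) = cn n - cn n.+1 - (1 - c).
Proof.
elim: n => [|n IH].
  by rewrite /geom big_ord0 mulr0 -[0](scale0r 1) revalZ mul0r mulr0 expr0 expr1/=; ring.
rewrite /geom big_ord_recr/= -/(geom n) (mulrDr 'X) revalD -exprS revalXn (mulrDr (2 * (1 - c))) IH chebyshev.
ring.
Qed.

(** The Chebyshev recurrence summed twice; the factor 2 (1 - c) is kept on the left so that no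
    division occurs at x = 1. *)
Lemma reval_X_hat N :
  2 * (1 - c) * reval x ('X * hat N) = 1 - cn N.+1 - N.+1%:R * (1 - c).
Proof.
elim: N => [|n IH].
  by rewrite /hat big_ord0 mulr0 -[0](scale0r 1) revalZ mul0r mulr0 expr1; ring.
rewrite hatS (mulrDr 'X) revalD (mulrDr (2 * (1 - c))) IH reval_X_geom -(natr1 n.+1); ring.
Qed.

(** This is |1 - x^(n+1)|^2 <= 2 |1 - x|^2 + 2 |1 - x^n|^2, halved, from 1 - x^(n+1) = (1 - x) + x
    (1 - x^n). The defect is half the sum of the two squares supplied. *)
Lemma cnS_bound n : 1 - cn n.+1 <= 2 * (1 - c) + 2 * (1 - cn n).
Proof.
have := circle_pow n; have := circle_eq x1; rewrite cnS.
have := sqr_ge0 (Im x - sn n); have := sqr_ge0 (1 - c + (1 - cn n)).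
set a := c; set b := Im x; set d := cn n; set e := sn n; nra.
Qed.

(** The only negative term is - (1 - cos ((N + 1) t)) / 2; by [cnS_bound] it is paid for by the last
    term of the sum and by (N + 1) (1 - c) / 2. *)
Lemma reval_backward N : (0 < N)%N ->
  0 <= reval x ((1 - 'X) * hat N + 2^-1 *: ((1 - 'X) ^+ 2 * hat N)).
Proof.
case: N => // N _; rewrite revalD revalZ reval_sqr_1subX reval_1subX_hat.
have := reval_X_hat N.+1; set h := reval x _ => hE.
rewrite big_ord_recr/=.
have : 0 <= \sum_(l < N) (1 - cn l.+1) by apply: sumr_ge0 => l _; rewrite subr_ge0 cn_le1.
have := cnS_bound N.+1; have : 0 <= N%:R * (1 - c) by rewrite mulr_ge0// subr_ge0 Re_le1.
have := Re_le1; have := cn_le1 N.+1.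
move: hE; rewrite -(natr1 N.+1) -(natr1 N).
set s := \sum_(_ < _) _; set d := cn N.+1; set f := cn N.+2; lra.
Qed.

(** From |sin (N t)| <= N |sin t|, by induction with the addition formula. *)
Lemma sn_bound N : Im x * sn N <= N%:R * Im x ^+ 2.
Proof.
suff : `|sn N| <= N%:R * `|Im x|.
  have -> : Im x ^+ 2 = `|Im x| * `|Im x| by rewrite -expr2 real_normK ?num_real.
  by move=> sN; rewrite (le_trans (ler_norm _))// normrM mulrC mulrA ler_wpM2r.
elim: N => [|N IH]; first by rewrite expr0 mul0r normr0.
have c1 : `|c| <= 1.
  by rewrite -(@ler_pXn2r _ 2) ?nnegrE// real_normK ?num_real// expr1n -(circle_eq x1) lerDl sqr_ge0.
have cN : `|cn N| <= 1.
  by rewrite -(@ler_pXn2r _ 2) ?nnegrE// real_normK ?num_real// expr1n -(circle_pow N) lerDl sqr_ge0.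
rewrite snS -natr1 mulrDl mul1r (le_trans (ler_normD _ _))// !normrM lerD//.
  by rewrite (le_trans _ IH)// ler_piMl.
by rewrite ler_piMr.
Qed.

(** Telescoping: (1 - c) (cn l + cn (l+1)) = Im x (sn (l+1) - sn l). *)
Lemma sum_cn N :
  (1 - c) * \sum_(l < N) (cn l + cn l.+1) = Im x * sn N.
Proof.
elim: N => [|N IH]; first by rewrite big_ord0 !mulr0.
rewrite big_ord_recr/= mulrDr IH snS cnS.
have : Im x ^+ 2 = 1 - c ^+ 2 by rewrite -(circle_eq x1); ring.
set a := c; set b := Im x; set d := cn N; set e := sn N; move=> bE.
have -> : b * (a * e + b * d) = a * b * e + b ^+ 2 * d by ring.
rewrite bE; ring.
Qed.

(** In terms of the trapezoidal sum [Z] of the cosines, the bound Z <= (N + 1) (1 + c) leaves at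
    least (N + 1) (1 - c)^2. *)
Lemma reval_centered N :
  0 <= reval x ((1 - 'X) * hat N.+1 + 2^-1 *: ((1 - 'X) ^+ 2 * (N.+1%:R%:P + hat N))).
Proof.
rewrite revalD revalZ reval_sqr_1subX reval_1subX_hat (mulrDr 'X) revalD.
have -> : 'X * N.+1%:R%:P = N.+1%:R *: 'X :> {poly R} by rewrite mulrC mul_polyC.
rewrite revalZ revalX; have := reval_X_hat N; set h := reval x _ => hE.
have sumE n : \sum_(l < n) (cn l + cn l.+1) = 2 * \sum_(l < n) cn l.+1 + 1 - cn n.
  elim: n => [|n IH]; first by rewrite !big_ord0 expr0 /=; ring.
  by rewrite !big_ord_recr/= IH; ring.
have -> : \sum_(l < N.+1) (1 - cn l.+1) = N.+1%:R - \sum_(l < N.+1) cn l.+1.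
  by rewrite sumrB sumr_const card_ord.
have := sumE N.+1; set s := \sum_(_ < _) cn _.+1; set Z := \sum_(_ < _) _ => ZE.
(* The bound on [Z] divides by 1 - c; at x = 1 the whole expression is 0. *)
have c1 := Re_le1; have [c1e|c1n] := eqVneq c 1.
  have xE : x = 1.
    have := circle_eq x1; move: c1e; case: x => a b /= ->; rewrite expr1n => /eqP.
    by rewrite -subr_eq0 addrAC subrr add0r sqrf_eq0 => /eqP ->.
  move: hE; rewrite /s c1e xE subrr !mulr0 mul0r => _.
  under eq_bigr do rewrite expr1n; rewrite sumr_const card_ord /=.
  by rewrite subrr oppr0 mul0r mulr0 addr0.
have c1s : 0 < 1 - c by rewrite subr_gt0 lt_neqAle c1n.
have ZN : Z <= N.+1%:R * (1 + c).
  rewrite -(ler_pM2l c1s) /Z sum_cn (le_trans (sn_bound _))//.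
  have -> : Im x ^+ 2 = 1 - c ^+ 2 by rewrite -(circle_eq x1); ring.
  by rewrite le_eqVlt; apply/orP; left; apply/eqP; ring.
have : 0 <= N.+1%:R * (1 - c) * (1 - c) by rewrite !mulr_ge0// ltW.
move: hE ZE ZN; set n := N.+1%:R; set f := cn N.+1 => hE ZE ZN; lra.
Qed.

End OnCircle.
End Chebyshev.

(** * Approximation of the symbol in l1 by polynomials with nonnegative real part on the circle *)

Section SymbolApproximation.
Context {R : realType}.
Implicit Types (f e b : nat -> R) (p : {poly R}).

Definition diff1 f (m : nat) : R := f m - (if m is m'.+1 then f m' else 0).

(* The generating function of [fold1 true f] is [f 0 + (F(X) - f 0) / X]. *)
Definition fold1 (c : bool) f (m : nat) : R :=
  if c then (if m is 0 then f 0%N + f 1%N else f m.+1) else f m.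

(* Coefficients of [(1 - X) (E + B) + (1 - X)^2 B' / 2], where [E], [B] and [B']
   are the generating functions of [e], [b] and [fold1 c b]. *)
Definition symbol c e b (m : nat) : R :=
  diff1 (fun i => e i + b i) m + 2^-1 * diff1 (diff1 (fold1 c b)) m.

Lemma coef_1subX p m : ((1 - 'X) * p)`_m = diff1 (fun i => p`_i) m.
Proof. by rewrite mulrBl mul1r coefB coefXM; case: m. Qed.

Lemma eq_diff1 f g : f =1 g -> diff1 f =1 diff1 g.
Proof. by move=> fg [|m]; rewrite /diff1 !fg. Qed.

Lemma diff1B f g m : diff1 (fun i => f i - g i) m = diff1 f m - diff1 g m.
Proof. by case: m => [|m]; rewrite /diff1; ring. Qed.

Lemma sum_diff1_le f n : \sum_(i < n) `|diff1 f i| <= 2 * \sum_(i < n) `|f i|.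
Proof.
rewrite mulr_natl mulr2n.
case: n => [|n]; first by rewrite !big_ord0 addr0.
rewrite big_ord_recl {1}/diff1 subr0.
apply: (@le_trans _ _ (`|f 0%N| + \sum_(i < n) (`|f i.+1| + `|f i|))).
  by rewrite lerD2l; apply: ler_sum => i _; rewrite /diff1 /= ler_normB.
rewrite big_split/= addrA -[X in X + _ <= _](big_ord_recl n (fun i => `|f i|)) lerD2l.
by rewrite big_ord_recr/= lerDl.
Qed.

(** The jump at index 0 contributes [f 0] and the later decrements telescope. *)
Lemma sum_diff1_noninc f n : (forall m, 0 <= f m) -> (forall m, f m.+1 <= f m) ->
  \sum_(i < n) `|diff1 f i| <= 2 * f 0%N.
Proof.
move=> f0 fS; suff H : \sum_(i < n.+1) `|diff1 f i| = 2 * f 0%N - f n.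
  apply: (@le_trans _ _ (\sum_(i < n.+1) `|diff1 f i|)).
    by rewrite big_ord_recr/= lerDl.
  by rewrite H lerBlDr lerDl.
elim: n => [|n IH].
  by rewrite big_ord1 /diff1 subr0 ger0_norm//; ring.
by rewrite big_ord_recr/= IH /diff1 ler0_norm ?subr_le0//; ring.
Qed.

Lemma coef_geom n m : (geom n : {poly R})`_m = (m < n)%:R.
Proof.
elim: n => [|n IH]; first by rewrite /geom big_ord0 coef0.
rewrite /geom big_ord_recr/= -/(geom n) coefD IH coefXn -natrD; congr (_%:R).
by lia.
Qed.

Lemma coef_hat N m : (hat N : {poly R})`_m = (N - m)%N%:R.
Proof.
elim: N => [|N IH]; first by rewrite /hat big_ord0 coef0.
rewrite hatS coefD IH coef_geom -natrD; congr (_%:R); lia.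
Qed.

(** Folding the tent [hat N.+1] shifts it left to [hat N] and adds its first coefficient N + 1 at
    index 0. *)
Definition fold_hat (c : bool) N : {poly R} :=
  if c then N.+1%:R%:P + hat N else hat N.+1.

Lemma coef_fold_hat c N m :
  (fold_hat c N)`_m = fold1 c (fun i => (hat N.+1 : {poly R})`_i) m.
Proof.
rewrite /fold_hat /fold1; case: c => //; rewrite coefD coefC !coef_hat.
by case: m => [|m]/=; rewrite ?add0r ?coef_hat ?subSS ?subn0.
Qed.

Lemma reval_fold_hat c N x : normc x = 1 ->
  0 <= reval x ((1 - 'X) * hat N.+1 + 2^-1 *: ((1 - 'X) ^+ 2 * fold_hat c N)).
Proof. by rewrite /fold_hat; case: c => x1; [exact: reval_centered|exact: reval_backward]. Qed.

Section Approximants.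
Variables (c : bool) (e b : nat -> R).
Hypotheses (e_ge0 : forall m, 0 <= e m) (e_noninc : forall m, e m.+1 <= e m).
Hypothesis e_lim : forall eta : R, 0 < eta -> exists M, e M <= eta.
Hypotheses (b_ge0 : forall m, 0 <= b m).
Hypothesis b_convex : forall m, 2 * b m.+1 <= b m + b m.+2.
Hypothesis b_lim : forall eta : R, 0 < eta ->
  exists M, forall m, (M <= m)%N -> b m <= eta.

(** A convex sequence that rises once keeps rising, which contradicts the limit 0. *)
Let b_noninc m : b m.+1 <= b m.
Proof.
rewrite leNgt; apply/negP => bm.
have inc k : b (m + k)%N < b (m + k).+1.
  by elim: k => [|k IH]; rewrite ?addn0// addnS; have := b_convex (m + k); lra.
have big k : b m.+1 <= b (m.+1 + k)%N.
  elim: k => [|k IH]; first by rewrite addn0.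
  by rewrite (le_trans IH)// addnS ltW// addSn -addnS inc.
have bm1 : 0 < b m.+1 by exact: le_lt_trans bm.
have [M bM] := b_lim (divr_gt0 bm1 (ltr0Sn _ 1)).
have := bM (m.+1 + M)%N (leq_addl _ _); have := big M; lra.
Qed.

Let curv N := b N - 2 * b N.+1 + b N.+2.

Let curv_ge0 N : 0 <= curv N.
Proof. by rewrite /curv; have := b_convex N; lra. Qed.

(** Summation by parts, once for [e] and twice for [b], truncated at [M]; the weights are
    nonnegative. *)
Let epoly M : {poly R} := \sum_(N < M) (e N - e N.+1) *: geom N.+1.

Let bpoly M : {poly R} := \sum_(N < M) curv N *: hat N.+1.

Let fpoly M : {poly R} := \sum_(N < M) curv N *: fold_hat c N.

(** What truncation leaves of [b]: the line through its values at [M] and M + 1 before [M], and [b]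
    itself from [M] on. *)
Let brest M m : R := if (M <= m)%N then b m else b M + (M - m)%:R * (b M - b M.+1).

Let eresidue M m : e m - (epoly M)`_m = e (maxn m M).
Proof.
elim: M => [|M IH]; first by rewrite /epoly big_ord0 coef0 subr0 maxn0.
rewrite /epoly big_ord_recr/= -/(epoly M) coefD opprD addrA IH coefZ coef_geom.
have [mM|Mm] := leqP m M.
  by rewrite ltnS mM mulr1 (maxn_idPr (leqW mM)); ring.
by rewrite ltnS leqNgt Mm mulr0 subr0 (maxn_idPl Mm).
Qed.

Let bresidue M m : b m - (bpoly M)`_m = brest M m.
Proof.
elim: M => [|M IH]; first by rewrite /bpoly big_ord0 coef0 subr0.
rewrite /bpoly big_ord_recr/= -/(bpoly M) coefD opprD addrA IH coefZ coef_hat.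
rewrite /brest /curv; have [Mm|mM] := leqP M.+1 m.
  by rewrite (ltnW Mm) (eqP Mm) mulr0 subr0.
rewrite subSn//.
have [Mm|mM'] := leqP M m.
  have -> : m = M by apply/eqP; rewrite eqn_leq Mm -ltnS mM.
  by rewrite subnn; ring.
by rewrite -natr1; ring.
Qed.

Let fresidue M m : fold1 c b m - (fpoly M)`_m = fold1 c (brest M) m.
Proof.
have -> : (fpoly M)`_m = fold1 c (fun i => (bpoly M)`_i) m.
  rewrite /fold1 !coef_sum; case: c => [|]; last by apply: eq_bigr => N _; rewrite !coefZ.
  case: m => [|m].
    rewrite -big_split; apply: eq_bigr => N _.
    by rewrite !coefZ coef_fold_hat /fold1 mulrDr.
  apply: eq_bigr => N _.
  by rewrite !coefZ coef_fold_hat.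
rewrite /fold1; case: c; last exact: bresidue.
by case: m => [|m]; rewrite -!bresidue//; ring.
Qed.

Let brest_noninc M m : brest M m.+1 <= brest M m.
Proof.
rewrite /brest; have [Mm|mM] := leqP M m; first by rewrite (leqW Mm).
have bM : 0 <= b M - b M.+1 by rewrite subr_ge0.
have [Mm1|mM1] := leqP M m.+1.
  have -> : M = m.+1 by apply/eqP; rewrite eqn_leq Mm1 mM.
  by rewrite lerDl mulr_ge0// subr_ge0.
by rewrite lerD2l ler_wpM2r// ler_nat leq_sub2l.
Qed.

Let brest_ge0 M m : 0 <= brest M m.
Proof. by rewrite /brest; case: ifP => // _; rewrite addr_ge0// mulr_ge0// subr_ge0. Qed.

Let fold_brest_noninc M m : fold1 c (brest M) m.+1 <= fold1 c (brest M) m.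
Proof.
rewrite /fold1; case: c; last exact: brest_noninc.
case: m => [|m]; last exact: brest_noninc.
rewrite (le_trans (brest_noninc _ _))// lerDr//.
Qed.

Let fold_brest_ge0 M m : 0 <= fold1 c (brest M) m.
Proof. by rewrite /fold1; case: c => //; case: m => //; rewrite addr_ge0. Qed.

Let symbol_poly M : {poly R} :=
  (1 - 'X) * (epoly M + bpoly M) + 2^-1 *: ((1 - 'X) ^+ 2 * fpoly M).

Let symbol_residue M m : symbol c e b m - (symbol_poly M)`_m =
  diff1 (fun i => e (maxn i M)) m + diff1 (brest M) m
  + 2^-1 * diff1 (diff1 (fold1 c (brest M))) m.
Proof.
rewrite /symbol_poly coefD coef_1subX coefZ expr2 -mulrA coef_1subX.
rewrite -(eq_diff1 (eresidue M)) -(eq_diff1 (bresidue M)).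
rewrite -(eq_diff1 (eq_diff1 (fresidue M))).
have -> : diff1 (diff1 (fun i => fold1 c b i - (fpoly M)`_i)) m =
    diff1 (diff1 (fold1 c b)) m - diff1 (fun i => ((1 - 'X) * fpoly M)`_i) m.
  by rewrite -diff1B; apply: eq_diff1 => i; rewrite diff1B coef_1subX.
by rewrite /symbol /diff1; case: m => [|m]; rewrite !coefD; ring.
Qed.

(** Each residue is nonnegative and nonincreasing, so its variation is at most twice its value at 0;
    the second difference costs another factor 2, offset by 1/2. *)
Let sum_residue M n : \sum_(i < n) `|symbol c e b i - (symbol_poly M)`_i| <=
  2 * e M + 2 * brest M 0 + 2 * fold1 c (brest M) 0.
Proof.
apply: (@le_trans _ _ (\sum_(i < n) `|diff1 (fun i => e (maxn i M)) i|
  + \sum_(i < n) `|diff1 (brest M) i|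
  + \sum_(i < n) 2^-1 * `|diff1 (diff1 (fold1 c (brest M))) i|)).
  rewrite -!big_split/=; apply: ler_sum => i _; rewrite symbol_residue.
  rewrite (le_trans (ler_normD _ _))// normrM (@ger0_norm _ 2^-1) ?invr_ge0// lerD2r.
  exact: ler_normD.
rewrite !lerD//.
- rewrite -[X in 2 * e X]max0n; apply: sum_diff1_noninc => m //.
  by have [mM|Mm] := leqP M m; [rewrite (maxn_idPl (leqW mM))|rewrite (maxn_idPr Mm)].
- exact: sum_diff1_noninc.
rewrite -mulr_sumr ler_pdivrMl// (le_trans (sum_diff1_le _ _))// ler_wpM2l//.
exact: sum_diff1_noninc.
Qed.

Let slope_noninc k j : b (k + j)%N - b (k + j).+1 <= b k - b k.+1.
Proof. by elim: j => [|j IH]; rewrite ?addn0// addnS; have := b_convex (k + j); lra. Qed.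

Let slope_le M k : (k <= M)%N -> k%:R * (b M - b M.+1) <= b (M - k)%N - b M.
Proof.
elim: k => [|k IH] kM; first by rewrite mul0r subn0 subrr.
have := slope_noninc (M - k.+1)%N k.+1; rewrite subnK// subnSK//.
by have := IH (ltnW kM); rewrite -natr1; lra.
Qed.

(* Convexity bounds the intercept at [0] of the tangent to [b] at [2 K]. *)
Let brest0_le K : brest K.*2 0 <= 3 * b K.
Proof.
rewrite /brest; case: ifP => [|_].
  by rewrite leqn0 double_eq0 => /eqP ->; have := b_ge0 0; lra.
have := @slope_le K.*2 K; rewrite -addnn leq_addr addKn => /(_ isT).
by rewrite subn0 natrD; have := b_ge0 (K + K); have := b_ge0 K; lra.
Qed.

Let noninc_le f m n : (forall k, f k.+1 <= f k) -> (m <= n)%N -> f n <= f m.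
Proof.
move=> fS /subnKC <-; elim: (n - m)%N => [|k IH]; first by rewrite addn0.
by rewrite addnS (le_trans (fS _)).
Qed.

Lemma symbol_approx (eta : R) : 0 < eta -> exists p : {poly R},
  [/\ forall n, \sum_(i < n) `|symbol c e b i - p`_i| <= eta,
      forall x, normc x = 1 -> (e 0 - e 1) * (1 - Re x) <= reval x p &
      p.[1] = 0].
Proof.
move=> eta0; have eta40 : 0 < eta / 40 by rewrite divr_gt0.
have [[K1 eK] [K2 bK]] := (e_lim eta40, b_lim eta40).
(* The residues add up to at most 2 + 6 + 12 fortieths of [eta]. [K] is a successor so that
   [epoly M] contains its term of index 0. *)
pose K := (K1 + K2).+1; pose M := K.*2; exists (symbol_poly M); split.
- move=> n; apply: (le_trans (sum_residue M n)).
  have eM : e M <= eta / 40.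
    by rewrite (le_trans _ eK)// noninc_le// /M /K; lia.
  have bK' : b K <= eta / 40 by apply: bK; rewrite /K; lia.
  have r0 : brest M 0 <= 3 * (eta / 40) by have := brest0_le K; rewrite -/M; lra.
  have f0 : fold1 c (brest M) 0 <= 2 * brest M 0.
    by have := brest_noninc M 0; have := brest_ge0 M 0; rewrite /fold1; case: c; lra.
  by lra.
(* The tents and their folded versions combine into nonnegative terms; of the [e] part only index 0
   is kept, which gives the lower bound. *)
- move=> x x1; rewrite /symbol_poly (mulrDr (1 - 'X)) -addrA revalD ler_wpDr//.
    rewrite /bpoly /fpoly !mulr_sumr scaler_sumr -big_split/= reval_sum.
    apply: sumr_ge0 => N _; rewrite -!scalerAr scalerA (mulrC 2^-1) -scalerA -scalerDr.
    by rewrite revalZ mulr_ge0// reval_fold_hat.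
  rewrite /epoly mulr_sumr reval_sum /M /K doubleS big_ord_recl -scalerAr revalZ.
  rewrite reval_1subX_geom expr1 lerDl sumr_ge0// => N _.
  by rewrite -scalerAr revalZ reval_1subX_geom mulr_ge0// subr_ge0// cn_le1.
- have h1 : (1 - 'X : {poly R}).[1] = 0 by rewrite hornerD hornerN hornerX hornerC subrr.
  by rewrite /symbol_poly expr2 -mulrA hornerD hornerZ !hornerM h1 !mul0r mulr0 addr0.
Qed.

End Approximants.
End SymbolApproximation.

(** * The kernel sequences *)

Section PositivePower.
Context {R : realType}.
Implicit Types (p y : R).

(* Unlike [powR], which is [1] on negative bases, this is continuous for [0 < p]. *)
Definition pospow p y : R := (Num.max 0 y) `^ p.

Lemma pospowE p y : 0 <= y -> pospow p y = y `^ p.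
Proof. by move=> y0; rewrite /pospow max_r. Qed.

Lemma near_pospow p y : 0 < y -> \forall t \near y, pospow p t = t `^ p.
Proof.
move=> y0; near=> t; apply: pospowE; apply: ltW; near: t.
exact: lt_nbhsr.
Unshelve. all: by end_near. Qed.

Lemma is_derive_pospow p y : 0 < y -> is_derive y 1 (pospow p) (p * y `^ (p - 1)).
Proof.
move=> y0; apply: near_eq_is_derive (is_derive1_powR p y0).
by have := near_pospow p y0; apply: filterS => t ->.
Qed.

Lemma continuous_pospow p : 0 < p -> continuous (pospow p).
Proof.
move=> p0.
have at0 : {for 0, continuous (pospow p)}.
  apply/cvgrPdist_le => e e0.
  have : \forall t \near (0 : R), `|t| <= e `^ p^-1 by apply: nbhs0_le; exact: powR_gt0.
  apply: filterS => t te.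
  rewrite pospowE// powR0 ?gt_eqF// sub0r normrN ger0_norm ?powR_ge0//.
  have -> : e = (e `^ p^-1) `^ p by rewrite -powRrM mulVf ?gt_eqF// powRr1// ltW.
  rewrite ge0_ler_powR ?nnegrE ?powR_ge0 ?le_max ?lexx ?(ltW p0)//.
  by rewrite ge_max powR_ge0/= (le_trans (ler_norm _)).
move=> y; have [y0|y0|->//] := ltgtP y 0.
- apply: (@near_cst_continuous _ _ 0); near=> t.
  rewrite /pospow max_l ?powR0 ?gt_eqF//; apply: ltW; near: t.
  exact: lt_nbhsl.
- have := is_derive_pospow p y0 => -[+ _].
  by move=> /derivable1_diffP/differentiable_continuous.
Unshelve. all: by end_near. Qed.

Lemma pospow_le p x y : 0 <= p -> x <= y -> pospow p x <= pospow p y.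
Proof.
move=> p0 xy; have H : Num.max 0 x <= Num.max 0 y by rewrite ge_max !le_max lexx xy orbT.
by apply: ge0_ler_powR => //; rewrite nnegrE le_max lexx.
Qed.

Lemma powRN_le p x y : 0 <= p -> 0 < x -> x <= y -> y `^ (- p) <= x `^ (- p).
Proof.
move=> p0 x0 xy; have y0 := lt_le_trans x0 xy.
rewrite !powRN lef_pV2 ?posrE ?powR_gt0//.
by apply: ge0_ler_powR => //; rewrite nnegrE ltW.
Qed.

Lemma powRN_midconvex p y : 0 <= p -> 0 < y ->
  2 * (y + 1) `^ (- p) <= y `^ (- p) + (y + 2) `^ (- p).
Proof.
move=> p0 y0; have y20 : 0 < y + 2 by lra.
set a := y `^ (- p); set b := (y + 2) `^ (- p).
have [a0 b0] : 0 < a /\ 0 < b by rewrite !powR_gt0.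
(* AM-GM, together with [y (y + 2) <= (y + 1)^2] *)
have ab : ((y + 1) `^ (- p)) ^+ 2 <= a * b.
  have y10 : 0 <= y + 1 by lra.
  rewrite expr2 /a /b -(powRM _ y10 y10) -(powRM _ (ltW y0) (ltW y20)).
  by apply: powRN_le => //; [rewrite mulr_gt0|nra].
rewrite -(@ler_pXn2r _ 2) ?nnegrE ?mulr_ge0 ?addr_ge0 ?powR_ge0//.
have := sqr_ge0 (a - b); move: ab; set d := (y + 1) `^ _; nra.
Qed.

(** The trapezoidal rule underestimates the integral of the concave [G]. The auxiliary [h] has
    derivative G y - G a - (y - a) f y, nonnegative by a second use of the mean value theorem; [f]
    may be singular at [a]. *)
Lemma trapezoid_le (F G f : R -> R) (a : R) :
  continuous F -> continuous G ->
  (forall y, y \in `]a, a + 1[ -> is_derive y 1 F (G y)) ->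
  (forall y, y \in `]a, a + 1[ -> is_derive y 1 G (f y)) ->
  (forall x y, a < x -> x <= y -> y < a + 1 -> f y <= f x) ->
  G a + G (a + 1) <= 2 * (F (a + 1) - F a).
Proof.
move=> cF cG dF dG fdec.
pose h := (2 \*: F) - (id - cst a) * (cst (G a) + G).
have a1 : a < a + 1 by rewrite ltrDl.
have dh y : y \in `]a, a + 1[ ->
    is_derive y 1 h (2 * G y - ((y - a) * f y + (G a + G y))).
  move=> yI; have dFy := dF _ yI; have dGy := dG _ yI.
  apply: is_derive_eq; rewrite /= /cst/= !add0r subr0.
  by congr (_ - (_ + _)); rewrite /GRing.scale/= mulr1.
have ch : {within `[a, a + 1], continuous h}.
  apply: continuous_subspaceT => y; apply: cvgB; first by apply: cvgZr; exact: cF.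
  by apply: cvgM; [apply: cvgB; [exact: cvg_id|exact: cvg_cst]|
    apply: cvgD; [exact: cvg_cst|exact: cG]].
have [z zI] := MVT a1 dh ch.
have [az za] : a < z /\ z < a + 1 by apply/andP; move: zI; rewrite in_itv.
have [||w wI Gw] := @MVT _ G f a z az.
- by move=> y yI; apply: dG; apply: subset_itvl yI; rewrite bnd_simp ltW.
- exact: continuous_subspaceT.
have : f z <= f w.
  by move: wI; rewrite in_itv/= => /andP[aw wz]; apply: fdec => //; exact: ltW.
have hE y : h y = 2 * F y - (y - a) * (G a + G y) by [].
rewrite !hE => fzw; have za0 : 0 < z - a by rewrite subr_gt0.
have := ler_wpM2r (ltW za0) fzw; lra.
Qed.

End PositivePower.

(** * Cell integrals of y^(-alpha): sign, monotonicity, convexity and limits *)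

Section KernelSequences.
Context {R : realType}.
Variable alpha : R.
Hypothesis alpha01 : 0 < alpha < 1.
Implicit Types (y t : R) (f : R -> R).

Let a0 : 0 < alpha. Proof. by case/andP: alpha01. Qed.
Let a1 : alpha < 1. Proof. by case/andP: alpha01. Qed.
Let oneBa : 0 < 1 - alpha. Proof. by rewrite subr_gt0. Qed.
Let twoBa : 0 < 2 - alpha. Proof. by have := a1; lra. Qed.

Definition prim1 (y : R) : R := pospow (1 - alpha) y / (1 - alpha).

Definition prim2 (y : R) : R := pospow (2 - alpha) y / ((1 - alpha) * (2 - alpha)).

Lemma continuous_prim1 : continuous prim1.
Proof.
by move=> y; apply: cvgM; [exact: continuous_pospow|exact: cvg_cst].
Qed.

Lemma continuous_prim2 : continuous prim2.
Proof.
by move=> y; apply: cvgM; [exact: continuous_pospow|exact: cvg_cst].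
Qed.

Lemma is_derive_scaled (f : R -> R) (y c d d' : R) :
  is_derive y 1 f d -> d / c = d' -> is_derive y 1 (fun t => f t / c) d'.
Proof.
move=> fd <-; have -> : (fun t => f t / c) = c^-1 \*: f.
  by apply/funext => t; rewrite /= /GRing.scale/= mulrC.
by apply: is_derive_eq; rewrite /GRing.scale/= mulrC.
Qed.

Lemma is_derive_prim1 y : 0 < y -> is_derive y 1 prim1 (y `^ (- alpha)).
Proof.
move=> y0; apply: (is_derive_scaled (is_derive_pospow _ y0)).
have -> : 1 - alpha - 1 = - alpha by ring.
by rewrite mulrAC mulfV ?mul1r// gt_eqF.
Qed.

Lemma is_derive_prim2 y : 0 < y -> is_derive y 1 prim2 (prim1 y).
Proof.
move=> y0; apply: (is_derive_scaled (is_derive_pospow _ y0)).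
have -> : 2 - alpha - 1 = 1 - alpha by ring.
by rewrite /prim1 pospowE ?ltW//; field; rewrite !gt_eqF.
Qed.

Lemma is_derive_shift (f : R -> R) (k y d : R) :
  is_derive (y + k) 1 f d -> is_derive y 1 (fun t => f (t + k)) d.
Proof.
move=> fd; rewrite -[d]mulr1.
apply: (@is_derive1_comp _ f (fun t => t + k) y d 1 fd).
have -> : (fun t : R => t + k) = id + cst k by [].
by apply: is_derive_eq; rewrite addr0.
Qed.

Lemma continuous_shift (f : R -> R) (k : R) : continuous f -> continuous (fun t => f (t + k)).
Proof.
move=> cf y; apply: (@continuous_comp _ _ _ (fun t => t + k) f); last exact: cf.
by apply: cvgD; [exact: cvg_id|exact: cvg_cst].
Qed.

(** The integral of y^(-alpha) over [m, m + 1]. *)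
Definition fdiff (m : nat) : R := prim1 m.+1%:R - prim1 m%:R.

(** By parts, the integral of 2 x (m + x)^(-alpha) over [0, 1]; it serves as [e]. *)
Definition fright (m : nat) : R :=
  2 * prim1 m.+1%:R - 2 * (prim2 m.+1%:R - prim2 m%:R).

(** The integral of (1 - 2 x) (m + x)^(-alpha) over [0, 1], which is twice the error of the
    trapezoidal rule for [prim1] on [m, m + 1]; it serves as [b]. *)
Definition ftrap (m : nat) : R := fdiff m - fright m.

Let itvS (m : nat) y : y \in `](m%:R : R), m%:R + 1[ -> 0 < y.
Proof. by rewrite in_itv/= => /andP[my _]; exact: le_lt_trans my. Qed.

Let natSB (m : nat) : m.+1%:R - m%:R = 1 :> R.
Proof. by rewrite -natr1 addrAC subrr add0r. Qed.

Lemma fdiff_mvt m : exists2 y, m%:R < y < m.+1%:R & fdiff m = y `^ (- alpha).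
Proof.
have mm : m%:R < m.+1%:R :> R by rewrite ltr_nat.
have [||y] := @MVT _ prim1 (fun y => y `^ (- alpha)) _ _ mm.
- by move=> y; rewrite -natr1 => /itvS; exact: is_derive_prim1.
- by apply: continuous_subspaceT; exact: continuous_prim1.
by rewrite in_itv/= natSB mulr1 => yI yE; exists y.
Qed.

Lemma fdiff_ge0 m : 0 <= fdiff m.
Proof. by have [y _ ->] := fdiff_mvt m; rewrite powR_ge0. Qed.

Lemma fdiff_noninc m : fdiff m.+1 <= fdiff m.
Proof.
have [y /andP[my ym] ->] := fdiff_mvt m; have [x /andP[mx _] ->] := fdiff_mvt m.+1.
by apply: powRN_le; rewrite ?ltW//; [exact: le_lt_trans my|exact: lt_trans mx].
Qed.

Lemma fdiff_lim (eta : R) : 0 < eta -> exists M, forall m, (M <= m)%N -> fdiff m <= eta.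
Proof.
(* [T] solves T^(-alpha) = eta. *)
move=> eta0; pose T := (eta^-1) `^ (alpha^-1).
have T0 : 0 < T by rewrite powR_gt0// invr_gt0.
exists (Num.truncn T).+1 => m Mm; have [y /andP[my _] ->] := fdiff_mvt m.
have Ty : T <= y.
  rewrite ltW// (le_lt_trans _ my)// (le_trans (ltW (Num.Theory.truncnS_gt T)))//.
  by rewrite ler_nat.
rewrite (le_trans (powRN_le (ltW a0) T0 Ty))//.
by rewrite /T powRN -powRrM mulVf ?gt_eqF// powRr1 ?invrK// invr_ge0 ltW.
Qed.

(** fdiff 1 <= 1 < 1 / (1 - alpha) = fdiff 0. Strictness makes the constant in the lower bound of
    the symbol positive. *)
Lemma fdiff1_lt_fdiff0 : fdiff 1 < fdiff 0.
Proof.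
have [y /andP[my _] ->] := fdiff_mvt 1.
have : y `^ (- alpha) <= 1.
  by rewrite (le_trans (powRN_le (ltW a0) ltr01 (ltW my)))// powR1.
move=> /le_lt_trans; apply.
rewrite /fdiff /prim1 !pospowE// powR1 powR0 ?gt_eqF// mul0r subr0 div1r.
by rewrite invf_gt1// ltrBlDr ltrDl.
Qed.

Lemma ftrap_ge0 m : 0 <= ftrap m.
Proof.
have := @trapezoid_le _ prim2 prim1 (fun y => y `^ (- alpha)) m%:R continuous_prim2
  continuous_prim1.
rewrite natr1 /ftrap /fdiff /fright => H.
suff : prim1 m%:R + prim1 m.+1%:R <= 2 * (prim2 m.+1%:R - prim2 m%:R) by lra.
apply: H.
- by move=> y; rewrite -natr1 => /itvS; exact: is_derive_prim2.
- by move=> y; rewrite -natr1 => /itvS; exact: is_derive_prim1.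
- by move=> x y mx xy _; apply: powRN_le => //; [exact: ltW|exact: le_lt_trans mx].
Qed.

Lemma is_derive_powR_shift (k y : R) : 0 <= k -> 0 < y ->
  is_derive y 1 (fun t : R => (t + k) `^ (- alpha)) (- (alpha * (y + k) `^ (- (alpha + 1)))).
Proof.
move=> k0 y0; apply: (@is_derive_shift (fun t => t `^ (- alpha))).
have yk : 0 < y + k by rewrite ltr_wpDr.
have := is_derive1_powR (- alpha) yk; rewrite mulNr.
by have -> : - alpha - 1 = - (alpha + 1) by ring.
Qed.

Let curvature (y : R) : R := y `^ (- alpha) - 2 * (y + 1) `^ (- alpha) + (y + 2) `^ (- alpha).

(** The derivative is - alpha times a second difference of y^(- alpha - 1), nonnegative by midpoint
    convexity. *)
Let curvature_noninc (x y : R) : 0 < x -> x <= y -> curvature y <= curvature x.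
Proof.
move=> x0; rewrite le_eqVlt => /orP[/eqP->//|xy].
pose df t := - (alpha * t `^ (- (alpha + 1))) + 2 * (alpha * (t + 1) `^ (- (alpha + 1)))
  - alpha * (t + 2) `^ (- (alpha + 1)).
have dc t : 0 < t -> is_derive t 1 curvature (df t).
  move=> t0.
  have d0 := is_derive_powR_shift (lexx 0) t0.
  have d1 := is_derive_powR_shift (@ler01 R) t0.
  have d2 := is_derive_powR_shift (ler0n R 2) t0.
  have -> : curvature = (fun t => (t + 0) `^ (- alpha)) -
      2 \*: (fun t => (t + 1) `^ (- alpha)) + (fun t => (t + 2) `^ (- alpha)).
    by apply/funext => s; rewrite /curvature -{1}[s]addr0.
  by apply: is_derive_eq; rewrite /df addr0 /GRing.scale/=; ring.
have [||z] := @MVT _ curvature df x y xy.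
- by move=> t; rewrite in_itv/= => /andP[xt _]; apply: dc; exact: lt_trans xt.
- apply: derivable_within_continuous => t; rewrite in_itv/= => /andP[xt _].
  by have [] := dc t (lt_le_trans x0 xt).
rewrite in_itv/= => /andP[xz _] dE.
suff : df z * (y - x) <= 0 by rewrite -dE subr_le0.
rewrite mulr_le0_ge0 ?subr_ge0 ?(ltW xy)//.
have a10 : 0 <= alpha + 1 by rewrite addr_ge0// ltW.
have := ler_wpM2l (ltW a0) (powRN_midconvex a10 (lt_trans x0 xz)).
by rewrite /df; set A := z `^ _; set B := (z + 1) `^ _; set D := (z + 2) `^ _; lra.
Qed.

(** The second difference of [ftrap] is the trapezoidal error of the second difference of [prim1],
    whose derivative [curvature] is nonincreasing. *)
Lemma ftrap_convex m : 2 * ftrap m.+1 <= ftrap m + ftrap m.+2.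
Proof.
pose d2 (f : R -> R) := f - 2 \*: (fun t => f (t + 1)) + (fun t => f (t + 2)).
have cont f : continuous f -> continuous (d2 f).
  move=> cf t; apply: cvgD; last exact: (@continuous_shift f 2 cf).
  apply: cvgB; first exact: cf.
  by apply: cvgZr; exact: (@continuous_shift f 1 cf).
have := @trapezoid_le _ (d2 prim2) (d2 prim1) curvature m%:R (cont _ continuous_prim2)
  (cont _ continuous_prim1).
have d2E f t : d2 f t = f t - 2 * f (t + 1) + f (t + 2) by [].
have shift k : 0 <= k -> forall y, 0 < y -> 0 < y + k.
  by move=> k0 y y0; rewrite ltr_wpDr.
have H : (forall y, y \in `](m%:R : R), m%:R + 1[ -> is_derive y 1 (d2 prim2) (d2 prim1 y)) /\
    (forall y, y \in `](m%:R : R), m%:R + 1[ -> is_derive y 1 (d2 prim1) (curvature y)).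
  split=> y /itvS y0.
    have := is_derive_prim2 y0.
    have := is_derive_shift (is_derive_prim2 (shift 1 ler01 _ y0)).
    have := is_derive_shift (is_derive_prim2 (shift 2 (ler0n R 2) _ y0)).
    by move=> *; apply: is_derive_eq.
  have := is_derive_prim1 y0.
  have := is_derive_shift (is_derive_prim1 (shift 1 ler01 _ y0)).
  have := is_derive_shift (is_derive_prim1 (shift 2 (ler0n R 2) _ y0)).
  by move=> *; apply: is_derive_eq.
case: H => H1 H2 /(_ H1 H2); rewrite !d2E => {}H1.
have {H1} := H1 (fun x y mx xy _ => curvature_noninc (le_lt_trans (ler0n R m) mx) xy).
have e1 : m%:R + 1 = m.+1%:R :> R by rewrite natr1.
have e2 : m%:R + 2 = m.+2%:R :> R by rewrite -natrD addn2.
have e3 : m.+1%:R + 1 = m.+2%:R :> R by rewrite natr1.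
have e4 : m.+1%:R + 2 = m.+3%:R :> R by rewrite -natrD addn2.
by rewrite e1 e2 e3 e4 /ftrap /fdiff /fright; lra.
Qed.

Lemma fright_ge0 m : 0 <= fright m.
Proof.
have mm : m%:R < m.+1%:R :> R by rewrite ltr_nat.
have [||y] := @MVT _ prim2 prim1 _ _ mm.
- by move=> y; rewrite -natr1 => /itvS; exact: is_derive_prim2.
- by apply: continuous_subspaceT; exact: continuous_prim2.
rewrite in_itv/= natSB mulr1 => /andP[_ ym].
rewrite /fright => ->; rewrite -mulrBr mulr_ge0// subr_ge0 ler_wpM2r//.
  by rewrite invr_ge0 ltW.
by apply: pospow_le; rewrite ltW.
Qed.

Lemma fright_le_fdiff m : fright m <= fdiff m.
Proof. by rewrite -subr_ge0 ftrap_ge0. Qed.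

Lemma ftrap_le_fdiff m : ftrap m <= fdiff m.
Proof. by rewrite /ftrap lerBlDr lerDl fright_ge0. Qed.

(** Two uses of the mean value theorem, on the differences of [prim2] and then of [prim1], write
    half the decrement as df z (m + 1 - y) >= 0. *)
Lemma fright_noninc m : fright m.+1 <= fright m.
Proof.
pose d1 (f : R -> R) := f - (fun t => f (t + 1)).
have d1E f t : d1 f t = f t - f (t + 1) by [].
have cont f : continuous f -> continuous (d1 f).
  by move=> cf t; apply: cvgB; [exact: cf|exact: (@continuous_shift f 1 cf)].
have pos1 y : 0 < y -> 0 < y + 1 by move=> y0; rewrite ltr_wpDr.
pose df (y : R) := y `^ (- alpha) - (y + 1) `^ (- alpha).
have D2 y : 0 < y -> is_derive y 1 (d1 prim2) (d1 prim1 y).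
  move=> y0; have := is_derive_prim2 y0.
  have := is_derive_shift (is_derive_prim2 (pos1 _ y0)).
  by move=> *; apply: is_derive_eq.
have D1 y : 0 < y -> is_derive y 1 (d1 prim1) (df y).
  move=> y0; have := is_derive_prim1 y0.
  have := is_derive_shift (is_derive_prim1 (pos1 _ y0)).
  by move=> *; apply: is_derive_eq.
have mm : m%:R < m%:R + 1 :> R by rewrite ltrDl.
have [||y yI] := @MVT _ (d1 prim2) (d1 prim1) _ _ mm.
- by move=> y /itvS; exact: D2.
- by apply: continuous_subspaceT; apply: cont; exact: continuous_prim2.
have y0 := itvS yI; move: yI; rewrite in_itv/= => /andP[my ym].
have [||z] := @MVT _ (d1 prim1) df _ _ ym.
- by move=> z; rewrite in_itv/= => /andP[yz _]; apply: D1; exact: lt_trans yz.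
- by apply: continuous_subspaceT; apply: cont; exact: continuous_prim1.
rewrite in_itv/= => /andP[yz _] E1 E2.
have dfz : 0 <= df z.
  have z0 := lt_trans y0 yz.
  by rewrite subr_ge0; apply: powRN_le => //; [exact: ltW|rewrite lerDl].
have : 0 <= df z * (m%:R + 1 - y) by rewrite mulr_ge0// subr_ge0 ltW.
rewrite -E1; move: E2; rewrite !d1E.
have e1 : m%:R + 1 = m.+1%:R :> R by rewrite natr1.
have e3 : m.+1%:R + 1 = m.+2%:R :> R by rewrite natr1.
by rewrite e1 e3 /fright; lra.
Qed.

Lemma fright1_lt_fright0 : fright 1 < fright 0.
Proof.
have [y /andP[my _] yE] := fdiff_mvt 1.
have y1 : y `^ (- alpha) <= 1.
  by rewrite (le_trans (powRN_le (ltW a0) ltr01 (ltW my)))// powR1.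
rewrite (le_lt_trans (fright_le_fdiff 1))// yE (le_lt_trans y1)//.
have -> : fright 0 = 2 / (2 - alpha).
  rewrite /fright /prim1 /prim2 !pospowE// !powR1 !powR0 ?gt_eqF//.
  by field; rewrite !gt_eqF.
by rewrite ltr_pdivlMr// mul1r; have := a0; lra.
Qed.

End KernelSequences.

(** * The weights of the discretised derivative *)

Section WeaklySingularIntegral.
Context {R : realType}.
Notation mu := (@lebesgue_measure R).
Implicit Types (a b T p : R).

Lemma measurable_left_continuous (f : R -> R) a b :
  (forall x, x < b -> {for x, continuous f}) -> measurable_fun `[a, b[ f.
Proof.
move=> cf; apply: (@measurable_funS _ _ _ _ `]-oo, b[) => //.
  by apply: subset_itvr; rewrite bnd_simp.
apply: open_continuous_measurable_fun => // x.
by rewrite inE/= in_itv/=; exact: cf.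
Qed.

(* The integrand may blow up at the right end point. *)
Lemma ge0_FTC2_left (f F : R -> R) a b : a < b ->
  (forall x, a <= x < b -> 0 <= f x) ->
  (forall x, x < b -> {for x, continuous f}) ->
  continuous F -> (forall x, x < b -> is_derive x 1 F (f x)) ->
  (\int[mu]_(x in `[a, b]) (f x)%:E = (F b - F a)%:E)%E.
Proof.
move=> ab f0 cf cF dF.
have mf := @measurable_left_continuous f a b cf.
rewrite -integral_itv_bndo_bndc; last exact/measurable_EFinP.
(* Monotone convergence along the intervals [a, c n], on each of which the integrand is continuous;
   [n.+2] ensures a < c n. *)
pose c (n : nat) : R := b - (b - a) / n.+2%:R.
have ba0 : 0 < b - a by rewrite subr_gt0.
have cb n : c n < b by rewrite /c ltrBlDr ltrDl divr_gt0.
have ac n : a < c n.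
  rewrite /c ltrBrDr -ltrBrDl ltr_pdivrMr// ltr_pMr//.
  by rewrite ltr1n.
pose E (n : nat) : set R := `[a, c n]%classic.
have EU : \bigcup_n E n = `[a, b[%classic.
  apply/seteqP; split => [x [n _]|x]; rewrite /E /= !in_itv/= => /andP[ax].
    by rewrite ax/= => /le_lt_trans; apply.
  move=> xb; have bx0 : 0 < b - x by rewrite subr_gt0.
  exists (Num.truncn ((b - a) / (b - x))) => //=; rewrite in_itv/= ax/= /c.
  rewrite lerBrDr -lerBrDl ler_pdivrMr// -ler_pdivrMl// mulrC.
  by rewrite (le_trans (ltW (Num.Theory.truncnS_gt _)))// ler_nat.
have Ehomo : {homo E : n m / (n <= m)%N >-> (n <= m)%O}.
  move=> n m nm; rewrite subsetEset; apply: subset_itvl; rewrite bnd_simp /c.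
  by rewrite lerB// ler_pM2l// lef_pV2 ?posrE// ler_nat !ltnS.
have mE n : measurable (E n) by exact: measurable_itv.
have sub n : E n `<=` `[a, b[%classic by apply: subset_itvl; rewrite bnd_simp.
have h1 n : measurable_fun (E n) (EFin \o f).
  by apply/measurable_EFinP; apply: measurable_funS mf => //; exact: measurable_itv.
have h2 n x : E n x -> (0 <= (EFin \o f) x)%E.
  by move=> /sub; rewrite /= in_itv/= lee_fin => /f0.
have lim1 : (\int[mu]_(x in E n) (EFin \o f) x)%E @[n --> \oo] -->
    (\int[mu]_(x in `[a, b[) (EFin \o f) x)%E.
  by rewrite -EU; exact: ge0_nondecreasing_set_cvg_integral.
have : (fun n => \int[mu]_(x in E n) (EFin \o f) x)%E @ \oo --> (F b - F a)%:E.
  have -> : (fun n => \int[mu]_(x in E n) (EFin \o f) x)%E = (fun n => (F (c n) - F a)%:E).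
    apply/funext => n; rewrite EFinB; apply: continuous_FTC2; first exact: ac.
    - apply: continuous_in_subspaceT => x; rewrite inE/= in_itv/= => /andP[_ xc].
      by apply: cf; exact: le_lt_trans (cb n).
    - split.
      + move=> x; rewrite in_itv/= => /andP[_ xc].
        by have [] := dF x (lt_trans xc (cb n)).
      + by apply: cvg_at_right_filter; exact: cF.
      + by apply: cvg_at_left_filter; exact: cF.
    - move=> x; rewrite in_itv/= => /andP[_ xc]; rewrite derive1E.
      by have [_ ->] := dF x (lt_trans xc (cb n)).
  apply: cvg_EFin; first exact: nearW.
  apply: cvgB; last exact: cvg_cst.
  have clim : c @ \oo --> b.
    have -> : b = b - (b - a) * 0 by rewrite mulr0 subr0.
    apply: cvgB; first exact: cvg_cst.
    apply: cvgM; first exact: cvg_cst.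
    by rewrite (cvg_shiftS (@harmonic R)); exact: cvg_harmonic.
  by apply: cvg_comp; [exact: clim|exact: cF].
by move=> lim2; exact: (cvg_unique _ lim1 lim2).
Qed.

Lemma is_derive_reflect (f : R -> R) T x d :
  is_derive (T - x) 1 f d -> is_derive x 1 (fun t => f (T - t)) (- d).
Proof.
move=> fd; rewrite -mulrN1.
apply: (@is_derive1_comp _ f (fun t => T - t) x d (-1) fd).
have -> : (fun t : R => T - t) = cst T - id by [].
by apply: is_derive_eq; rewrite sub0r.
Qed.

Lemma integral_powR p a b T : -1 < p -> a < b -> b <= T ->
  (\int[mu]_(x in `[a, b]) ((T - x) `^ p)%:E =
    (((T - a) `^ (p + 1) - (T - b) `^ (p + 1)) / (p + 1))%:E)%E.
Proof.
move=> p1 ab bT; have p10 : 0 < p + 1 by lra.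
pose F x := - (pospow (p + 1) (T - x) / (p + 1)).
have -> : ((T - a) `^ (p + 1) - (T - b) `^ (p + 1)) / (p + 1) = F b - F a.
  by rewrite /F !pospowE ?subr_ge0 ?(le_trans (ltW ab))//; ring.
have pos x : x < b -> 0 < T - x by move=> xb; rewrite subr_gt0 (lt_le_trans xb).
apply: ge0_FTC2_left => //.
- by move=> x _; exact: powR_ge0.
- move=> x xb; have [+ _] := is_derive_reflect (is_derive1_powR p (pos x xb)).
  by move=> /derivable1_diffP/differentiable_continuous.
- move=> x; apply: cvgN; apply: cvgM; last exact: cvg_cst.
  apply: (@continuous_comp _ _ _ (fun t => T - t) (pospow (p + 1))).
    by apply: cvgB; [exact: cvg_cst|exact: cvg_id].
  exact: continuous_pospow.
- move=> x xb.
  have := is_derive_reflect (is_derive_pospow (p + 1) (pos x xb)).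
  move=> D; have -> : F = (- (p + 1)^-1) \*: (fun t => pospow (p + 1) (T - t)).
    by apply/funext => t; rewrite /F /= /GRing.scale/= mulNr mulrC.
  apply: is_derive_eq; rewrite /GRing.scale/= mulrNN addrK mulrA mulVf ?mul1r//.
  by rewrite gt_eqF.
Qed.

Lemma integrable_powR p a b T : -1 < p -> a < b -> b <= T ->
  mu.-integrable `[a, b] (EFin \o (fun x => (T - x) `^ p)).
Proof.
move=> p1 ab bT; apply/integrableP; split.
  apply/measurable_EFinP/measurable_fun_itv_bndo_bndcP.
  apply: measurable_left_continuous => x xb.
  have Tx : 0 < T - x by rewrite subr_gt0 (lt_le_trans xb).
  have [+ _] := is_derive_reflect (is_derive1_powR p Tx).
  by move=> /derivable1_diffP/differentiable_continuous.
under eq_integral do rewrite /= ger0_norm ?powR_ge0//.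
by rewrite integral_powR// ltry.
Qed.

Lemma integral_powR_linear alpha a b T (c0 c1 : R) : 0 < alpha < 1 -> a < b -> b <= T ->
  fine (\int[mu]_(x in `[a, b]) ((T - x) `^ (- alpha) * (c0 + c1 * (T - x)))%:E)%E =
  c0 * (((T - a) `^ (1 - alpha) - (T - b) `^ (1 - alpha)) / (1 - alpha)) +
  c1 * (((T - a) `^ (2 - alpha) - (T - b) `^ (2 - alpha)) / (2 - alpha)).
Proof.
move=> /andP[a0 a1] ab bT.
have p0 : -1 < - alpha by lra.
have p1 : -1 < 1 - alpha by lra.
pose g0 x := (T - x) `^ (- alpha); pose g1 x := (T - x) `^ (1 - alpha).
transitivity (\int[mu]_(x in `[a, b]) (c0 * g0 x + c1 * g1 x))%R.
  congr fine; apply: eq_integral => x; rewrite inE/= in_itv/= => /andP[_ xb].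
  have Tx : 0 <= T - x by rewrite subr_ge0 (le_trans xb).
  have oa : 0 < 1 - alpha by rewrite subr_gt0.
  congr (_%:E); rewrite /g1 -(mulr_powRB1 Tx oa).
  have -> : 1 - alpha - 1 = - alpha by ring.
  by rewrite /g0; ring.
have i0 : mu.-integrable `[a, b] (EFin \o g0) by exact: integrable_powR.
have i1 : mu.-integrable `[a, b] (EFin \o g1) by exact: integrable_powR.
rewrite RintegralD//; last 2 first.
- by apply: (integrableZl _ c0 i0); exact: measurable_itv.
- by apply: (integrableZl _ c1 i1); exact: measurable_itv.
rewrite !RintegralZl// /Rintegral !integral_powR//=.
have -> : - alpha + 1 = 1 - alpha by ring.
by have -> : 1 - alpha + 1 = 2 - alpha by ring.
Qed.

End WeaklySingularIntegral.

(** * Derivatives of the interpolants and the contribution of one cell *)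

Section DiscreteDerivative.
Context {R : realType}.

Lemma sum_delta (g : nat -> R) A B j :
  \sum_(A <= l < B) g l * (l == j)%:R = (A <= j < B)%N%:R * g j.
Proof.
have [AB|/ltnW BA] := leqP A B; last first.
  by rewrite big_geq//; case: (leqP A j) => //= Aj; rewrite ?mul0r// ltnNge (leq_trans BA Aj) mul0r.
rewrite -(subnKC AB); elim: (B - A)%N => [|k IH].
  by rewrite addn0 big_geq//; case: leqP => Aj; rewrite ?mul0r//= ltnNge Aj mul0r.
rewrite addnS big_nat_recr ?leq_addr//= IH.
have [<-|jk] := eqVneq (A + k)%N j.
  by rewrite ltnn andbF ltnSn leq_addr mul0r add0r mulr1 mul1r.
by rewrite mulr0 addr0 ltnS [(j <= A + k)%N]leq_eqVlt [j == _]eq_sym (negbTE jk).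
Qed.

Variable dt : R.
Hypothesis dt0 : 0 < dt.
Implicit Types (u : nat -> R).

Lemma deriv_lagrange1 u s x : ((Defs.lagrange dt u s 1)^`()).[x] = dt^-1 * (u s.+1 - u s).
Proof.
rewrite /Defs.lagrange; under eq_bigr do rewrite big_mkcond/=.
rewrite !big_ord_recl !big_ord0/=.
rewrite /tg /bump/= !addn0 !addn1 -!natr1 !(poly.derivE, hornerE)/=.
have -> : s%:R * dt - (s%:R + 1) * dt = - dt by ring.
have -> : (s%:R + 1) * dt - s%:R * dt = dt by ring.
by field; rewrite gt_eqF.
Qed.

Lemma deriv_lagrange2 u s x : ((Defs.lagrange dt u s 2)^`()).[x] =
  dt^-1 * (u s.+1 - u s + (x / dt - s%:R - 2^-1) * (u s.+2 - 2 * u s.+1 + u s)).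
Proof.
rewrite /Defs.lagrange; under eq_bigr do rewrite big_mkcond/=.
rewrite !big_ord_recl !big_ord0/=.
rewrite /tg /bump/= !addn0 !addn1 !addn2 -!natr1 !(poly.derivE, hornerE)/=.
have -> : s%:R * dt - (s%:R + 1) * dt = - dt by ring.
have -> : (s%:R + 1) * dt - s%:R * dt = dt by ring.
have -> : s%:R * dt - (s%:R + 1 + 1) * dt = - (2 * dt) by ring.
have -> : (s%:R + 1 + 1) * dt - s%:R * dt = 2 * dt by ring.
have -> : (s%:R + 1) * dt - (s%:R + 1 + 1) * dt = - dt by ring.
have -> : (s%:R + 1 + 1) * dt - (s%:R + 1) * dt = dt by ring.
by field; rewrite gt_eqF.
Qed.

(** All pieces are brought to one form: a backward difference plus a second difference times 1/2 -
    y, where y = l - x / dt is the local coordinate from the right end of the cell. For k = 1 the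
    second difference is 0. *)
Lemma piece11 u n l x : (0 < l <= n)%N -> ((piece dt u 1 1 n l)^`()).[x] =
  dt^-1 * (u l - u l.-1 + (2^-1 - (l%:R - x / dt)) * 0).
Proof.
case: l => // l /andP[_ ln].
have -> : piece dt u 1 1 n l.+1 = Defs.lagrange dt u l 1.
  rewrite /piece /pinterp/=.
  have -> : (l < n - 1 + 1)%N by lia.
  by have -> : (l.+1 + 1 - 1 - 1 = l)%N by lia.
by rewrite deriv_lagrange1 mulr0 addr0.
Qed.

Lemma piece21 u n l x : (1 < n)%N -> (0 < l <= n)%N -> ((piece dt u 2 1 n l)^`()).[x] =
  dt^-1 * (u l - u l.-1 + (2^-1 - (l%:R - x / dt)) *
    (if (1 < l)%N then u l - 2 * u l.-1 + u l.-2 else 0)).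
Proof.
move=> n1; case: l => [//|[|l]] /andP[_ ln].
  have -> : piece dt u 2 1 n 1 = Defs.lagrange dt u 0 1 by [].
  by rewrite deriv_lagrange1 mulr0 addr0.
have -> : piece dt u 2 1 n l.+2 = Defs.lagrange dt u l 2.
  rewrite /piece /pinterp/=.
  have -> : (l.+1 < n - 1 + 1)%N by lia.
  by have -> : (l.+2 + 1 - 2 - 1 = l)%N by lia.
by rewrite deriv_lagrange2/= -!natr1; field; rewrite gt_eqF.
Qed.

Lemma piece22 u n l x : (1 < n)%N -> (0 < l <= n)%N -> ((piece dt u 2 2 n l)^`()).[x] =
  dt^-1 * (u l - u l.-1 + (2^-1 - (l%:R - x / dt)) *
    (if (l < n)%N then u l.+1 - 2 * u l + u l.-1 else u l - 2 * u l.-1 + u l.-2)).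
Proof.
move=> n1; case: l => [//|l] /andP[_ ln].
have [ln'|nl] := ltnP l.+1 n.
  have -> : piece dt u 2 2 n l.+1 = Defs.lagrange dt u l 2.
    rewrite /piece /pinterp/=.
    have -> : (l < n - 2 + 1)%N by lia.
    by have -> : (l.+1 + 2 - 2 - 1 = l)%N by lia.
  by rewrite deriv_lagrange2/= -!natr1; field; rewrite gt_eqF.
(* In the last cell the stencil moves back to the points of index n - 2, n - 1, n. *)
have -> : piece dt u 2 2 n l.+1 = Defs.lagrange dt u l.-1 2.
  rewrite /piece /pinterp/=.
  have -> : (l < n - 2 + 1)%N = false by lia.
  by have -> : (l.+1 + (n + 1 - l.+1) - 2 - 1 = l.-1)%N by lia.
have l0 : (0 < l)%N by lia.
by rewrite deriv_lagrange2/= -(prednK l0)/= -!natr1; field; rewrite gt_eqF.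
Qed.

Variable alpha : R.
Hypothesis alpha01 : 0 < alpha < 1.

Local Notation fdiff := (fdiff alpha).
Local Notation ftrap := (ftrap alpha).

Lemma mul_prim1 y : 0 <= y -> y * prim1 alpha y = (2 - alpha) * prim2 alpha y.
Proof.
move=> y0; case/andP: alpha01 => a0 a1; rewrite /prim1 /prim2 !pospowE//.
have p : 0 < 2 - alpha by lra.
rewrite -(mulr_powRB1 y0 p); have -> : 2 - alpha - 1 = 1 - alpha by ring.
by field; rewrite !subr_eq0 !gt_eqF//; lra.
Qed.

(** In the local coordinate y, t_n - x = dt (m + y) with m = n - l, so the weights of 1 and of 1/2 -
    y are [fdiff m] and half of [ftrap m]. *)
Lemma cell_integral (q : {poly R}) n l (D1 D2 : R) : (0 < l <= n)%N ->
  (forall x, q.[x] = dt^-1 * (D1 + (2^-1 - (l%:R - x / dt)) * D2)) ->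
  fine (\int[@lebesgue_measure R]_(x in `[tg dt l.-1, tg dt l])
     ((tg dt n - x) `^ (- alpha) * q.[x])%:E)%E =
  dt `^ (- alpha) * (fdiff (n - l) * D1 + 2^-1 * ftrap (n - l) * D2).
Proof.
move=> /andP[l0 ln] qE; case/andP: (alpha01) => a0 a1.
pose m := (n - l)%N; have nE : n = (m + l)%N by rewrite /m subnK.
(* The linear factor is re-expanded in powers of t_n - x, using l - x / dt = (t_n - x) / dt - m. *)
pose c0 := dt^-1 * (D1 + (2^-1 + m%:R) * D2); pose c1 := - (dt^-1 * dt^-1 * D2).
have -> : (fun x => ((tg dt n - x) `^ (- alpha) * q.[x])%:E) =
    (fun x => ((tg dt n - x) `^ (- alpha) * (c0 + c1 * (tg dt n - x)))%:E).
  apply/funext => x; congr (_ * _)%:E; rewrite qE /c0 /c1 /tg {1}nE natrD.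
  by field; rewrite gt_eqF.
have lE : l = l.-1.+1 by rewrite prednK.
have ab : tg dt l.-1 < tg dt l by rewrite /tg ltr_pM2r// ltr_nat {2}lE.
have bT : tg dt l <= tg dt n by rewrite /tg ler_pM2r// ler_nat.
rewrite integral_powR_linear//.
have Ta : tg dt n - tg dt l.-1 = m.+1%:R * dt.
  by rewrite /tg nE [in (m + l)%N]lE addnS -addSn natrD; ring.
have Tb : tg dt n - tg dt l = m%:R * dt by rewrite /tg nE natrD; ring.
rewrite Ta Tb !powRM ?ler0n ?(ltW dt0)// -/m.
have dt1 : dt `^ (1 - alpha) = dt * dt `^ (- alpha).
  by rewrite powRD ?powRr1 ?(ltW dt0)// (gt_eqF dt0) implybT.
have dt2 : dt `^ (2 - alpha) = dt * dt * dt `^ (- alpha).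
  have -> : 2 - alpha = 1 + (1 - alpha) by ring.
  by rewrite powRD ?powRr1 ?(ltW dt0)// ?dt1 ?mulrA// (gt_eqF dt0) implybT.
have P1 (k : nat) : k%:R `^ (1 - alpha) = (1 - alpha) * prim1 alpha k%:R.
  by rewrite /prim1 pospowE// mulrC divfK// gt_eqF// subr_gt0.
have P2 (k : nat) : k%:R `^ (2 - alpha) = (1 - alpha) * (2 - alpha) * prim2 alpha k%:R.
  rewrite /prim2 pospowE// mulrC divfK// mulf_neq0// gt_eqF//; lra.
rewrite P1 P1 P2 P2 dt1 dt2 /fdiff /ftrap /fright /fdiff.
have Q (k : nat) : prim2 alpha k%:R = k%:R * prim1 alpha k%:R / (2 - alpha).
  by rewrite mul_prim1// mulrC mulKf// gt_eqF//; lra.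
rewrite !Q -natr1 /c0 /c1.
set p := prim1 alpha _; set p' := prim1 alpha _; set E := dt `^ _.
by field; rewrite !gt_eqF//; lra.
Qed.

Local Notation coefD := (Defs.coefD alpha dt).
Local Notation gam := ((Defs.Gamma (1 - alpha))^-1).

Lemma coefD_cells k i n j (D1 D2 : nat -> R) :
  (forall l x, (0 < l <= n)%N -> ((piece dt (fun l => (l == j)%:R) k i n l)^`()).[x] =
     dt^-1 * (D1 l + (2^-1 - (l%:R - x / dt)) * D2 l)) ->
  coefD k i n j =
  gam * \sum_(1 <= l < n.+1) (fdiff (n - l) * D1 l + 2^-1 * ftrap (n - l) * D2 l).
Proof.
move=> pE; rewrite /Defs.coefD /Defs.Dfrac mulrCA; congr (_ * _).
rewrite mulr_sumr; apply: eq_big_nat => l /andP[l0 ln].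
rewrite (@cell_integral _ n l (D1 l) (D2 l)) ?l0//; last first.
  by move=> x; apply: pE; rewrite l0.
by rewrite mulrA -powRD ?addrN ?powRr0 ?mul1r// (gt_eqF dt0) implybT.
Qed.

End DiscreteDerivative.

(** * The weights as symbols, and decay of the starting weights *)

Section Weights.
Context {R : realType}.
Variables (alpha dt : R).
Hypotheses (alpha01 : 0 < alpha < 1) (dt0 : 0 < dt).

Local Notation fdiff := (fdiff alpha).
Local Notation fright := (fright alpha).
Local Notation ftrap := (ftrap alpha).
Local Notation coefD := (Defs.coefD alpha dt).
Local Notation gam := ((Defs.Gamma (1 - alpha))^-1).

Lemma coefD11 n j : coefD 1 1 n j =
  gam * ((0 < j < n.+1)%N%:R * fdiff (n - j) - (j.+1 < n.+1)%N%:R * fdiff (n - j.+1)).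
Proof.
rewrite (coefD_cells dt0 alpha01 (fun l x => @piece11 _ _ dt0 _ n l x)); congr (_ * _).
rewrite -[X in _ = X - _](sum_delta (fun l => fdiff (n - l))).
rewrite -[X in _ = _ - X](sum_delta (fun l => fdiff (n - l)) 1 n.+1 j.+1) -sumrB.
apply: eq_big_nat => -[//|l] _; rewrite mulr0 addr0 mulrBr.
by rewrite eqSS.
Qed.

Lemma coefD21 n j : (1 < n)%N -> coefD 2 1 n j =
  gam * ((0 < j < n.+1)%N%:R * fdiff (n - j) - (j.+1 < n.+1)%N%:R * fdiff (n - j.+1)
   + 2^-1 * ((1 < j < n.+1)%N%:R * ftrap (n - j)
             - 2 * ((1 < j.+1 < n.+1)%N%:R * ftrap (n - j.+1))
             + (j.+2 < n.+1)%N%:R * ftrap (n - j.+2))).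
Proof.
move=> n1; rewrite (coefD_cells dt0 alpha01 (fun l x => @piece21 _ _ dt0 _ n l x n1)).
congr (_ * _); rewrite big_split/=; congr (_ + _).
  rewrite -[X in _ = X - _](sum_delta (fun l => fdiff (n - l))).
  rewrite -[X in _ = _ - X](sum_delta (fun l => fdiff (n - l)) 1 n.+1 j.+1) -sumrB.
  by apply: eq_big_nat => -[//|l] _; rewrite mulrBr eqSS.
have n2 : (1 < n.+1)%N by exact: ltnW.
(* The first cell is linear, so the second differences start at l = 2. *)
rewrite big_ltn//= mulr0 add0r.
rewrite -[X in _ = _ * (X - _ + _)](sum_delta (fun l => ftrap (n - l))).
rewrite -[X in _ = _ * (_ - 2 * X + _)](sum_delta (fun l => ftrap (n - l)) 2 n.+1 j.+1).
rewrite -[X in _ = _ * (_ + X)](sum_delta (fun l => ftrap (n - l)) 2 n.+1 j.+2).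
rewrite mulr_sumr -sumrB -big_split/= mulr_sumr.
by apply: eq_big_nat => -[//|[//|l]] _; rewrite !eqSS/=; ring.
Qed.

Lemma coefD22 n j : (1 < n)%N -> coefD 2 2 n j =
  gam * ((0 < j < n.+1)%N%:R * fdiff (n - j) - (j.+1 < n.+1)%N%:R * fdiff (n - j.+1)
   + 2^-1 * ((0 < j.-1 < n)%N%:R * ftrap (n - j.-1)
             - 2 * ((0 < j < n)%N%:R * ftrap (n - j))
             + (j.+1 < n)%N%:R * ftrap (n - j.+1)
             + ((n == j)%:R - 2 * (n.-1 == j)%:R + (n.-2 == j)%:R) * ftrap 0)).
Proof.
move=> n1; rewrite (coefD_cells dt0 alpha01 (fun l x => @piece22 _ _ dt0 _ n l x n1)).
congr (_ * _); rewrite big_split/=; congr (_ + _).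
  rewrite -[X in _ = X - _](sum_delta (fun l => fdiff (n - l))).
  rewrite -[X in _ = _ - X](sum_delta (fun l => fdiff (n - l)) 1 n.+1 j.+1) -sumrB.
  by apply: eq_big_nat => -[//|l] _; rewrite mulrBr eqSS.
rewrite big_nat_recr ?(ltnW n1)//= ltnn subnn [RHS]mulrDr; congr (_ + _); last by ring.
(* The point ahead of cell l is [j] when l = j - 1; for j = 0 the truncated [j.-1] is 0 and lies
   outside the range. *)
rewrite -[X in _ = _ * (X - _ + _)](sum_delta (fun l => ftrap (n - l)) 1 n j.-1).
rewrite -[X in _ = _ * (_ - 2 * X + _)](sum_delta (fun l => ftrap (n - l)) 1 n j).
rewrite -[X in _ = _ * (_ + X)](sum_delta (fun l => ftrap (n - l)) 1 n j.+1).
rewrite mulr_sumr -sumrB -big_split/= mulr_sumr.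
apply: eq_big_nat => -[//|l] /andP[_ ->]; rewrite eqSS/=.
have -> : (l.+2 == j) = (l.+1 == j.-1) by lia.
by ring.
Qed.

Lemma omega11 m : omega alpha dt 1 1 m = gam * symbol false fdiff (fun=> 0) m.
Proof.
rewrite /omega coefD11 /symbol /fold1 /diff1; congr (_ * _).
case: m => [|[|m]]; rewrite ?addn1 ?subn1 ?subSS ?subn0/= ?subn2/= ?ltnS//=; ring.
Qed.

Lemma symbol_fright c m : symbol c fright ftrap m =
  diff1 fdiff m + 2^-1 * diff1 (diff1 (fold1 c ftrap)) m.
Proof.
rewrite /symbol; congr (_ + _); apply: eq_diff1 => i.
by rewrite /ftrap addrC subrK.
Qed.

Lemma omega21 m : omega alpha dt 2 1 m = gam * symbol false fright ftrap m.
Proof.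
rewrite /omega coefD21 ?addn2// symbol_fright /fold1 /diff1; congr (_ * _).
case: m => [|[|m]].
- by rewrite /=; ring.
- by rewrite /=; ring.
have -> : (m.+4 - 2 = m.+2)%N by lia.
have -> : (m.+4 - 3 = m.+1)%N by lia.
have -> : (m.+4 - 4 = m)%N by lia.
by rewrite /=; ring.
Qed.

(** The centred stencil of cell l ends one point ahead, which shifts [ftrap] by one; the last cell
    repeats the second difference of the cell before it, so [ftrap 0] is added to [ftrap 1]. This is
    the folding. *)
Lemma omega22 m : omega alpha dt 2 2 m = gam * symbol true fright ftrap m.
Proof.
rewrite /omega coefD22 ?addn2// symbol_fright /fold1 /diff1; congr (_ * _).
case: m => [|[|[|m]]].
- by rewrite /=; ring.
- by rewrite /=; ring.
- by rewrite /=; ring.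
have -> : (m.+3.+2 - 2 = m.+3)%N by lia.
have -> : (m.+3.+2 - 3 = m.+2)%N by lia.
have -> : (m.+3.+2 - 2.-1 = m.+4)%N by lia.
by rewrite /=; ring.
Qed.

(** A fixed starting value meets boundedly many cells, at offsets at most j + 2 <= 4 from [n];
    [5 <= n] keeps it off the stencil of the last cell. *)
Lemma coefD_bound k i n j : (k, i) \in [:: (1, 1); (2, 1); (2, 2)]%N ->
  (j <= 2)%N -> (5 <= n)%N -> `|coefD k i n j| <= `|gam| * (4 * fdiff (n - 4)).
Proof.
move=> ki j2 n5.
have mono a b : (a <= b)%N -> fdiff b <= fdiff a.
  move=> /subnKC <-; elim: (b - a)%N => [|c IH]; first by rewrite addn0.
  by rewrite addnS (le_trans (fdiff_noninc _ _)).
have F (b : bool) c : (c <= 4)%N -> 0 <= b%:R * fdiff (n - c) <= fdiff (n - 4).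
  move=> c4; have := fdiff_ge0 alpha01 (n - 4); have := fdiff_ge0 alpha01 (n - c).
  have : fdiff (n - c) <= fdiff (n - 4) by rewrite mono// leq_sub2l.
  by case: b => /= ? ? ?; rewrite ?mul1r ?mul0r; apply/andP; split; lra.
have T (b : bool) c : (c <= 4)%N -> 0 <= b%:R * ftrap (n - c) <= fdiff (n - 4).
  move=> c4; have := F true c c4; rewrite mul1r; have := ftrap_ge0 alpha01 (n - c).
  have := ftrap_le_fdiff alpha01 (n - c); have := fdiff_ge0 alpha01 (n - 4).
  by case: b => /= ? ? ? /andP[? ?]; rewrite ?mul1r ?mul0r; apply/andP; split; lra.
have n1 : (1 < n)%N by lia.
have [j3 j4] : (j <= 4)%N /\ (j.+1 <= 4)%N by lia.
have [j5 j6] : (j.+2 <= 4)%N /\ (j.-1 <= 4)%N by lia.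
move: ki; rewrite !inE => /or3P[]; rewrite xpair_eqE => /andP[/eqP -> /eqP ->].
- rewrite coefD11 normrM ler_wpM2l// ler_norml.
  have /andP[? ?] := F (0 < j < n.+1)%N j j3; have /andP[? ?] := F (j.+1 < n.+1)%N j.+1 j4.
  by apply/andP; split; lra.
- rewrite coefD21// normrM ler_wpM2l// ler_norml.
  have /andP[? ?] := F (0 < j < n.+1)%N j j3; have /andP[? ?] := F (j.+1 < n.+1)%N j.+1 j4.
  have /andP[? ?] := T (1 < j < n.+1)%N j j3; have /andP[? ?] := T (1 < j.+1 < n.+1)%N j.+1 j4.
  have /andP[? ?] := T (j.+2 < n.+1)%N j.+2 j5.
  by apply/andP; split; lra.
- rewrite coefD22// normrM ler_wpM2l// ler_norml.
  have -> : (n == j) = false by lia.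
  have -> : (n.-1 == j) = false by lia.
  have -> : (n.-2 == j) = false by lia.
  have /andP[? ?] := F (0 < j < n.+1)%N j j3; have /andP[? ?] := F (j.+1 < n.+1)%N j.+1 j4.
  have /andP[? ?] := T (0 < j.-1 < n)%N j.-1 j6; have /andP[? ?] := T (0 < j < n)%N j j3.
  have /andP[? ?] := T (j.+1 < n)%N j.+1 j4.
  by rewrite mulr0 subrr add0r mul0r addr0; apply/andP; split; lra.
Qed.

Lemma coefD_small k i (e : R) : (k, i) \in [:: (1, 1); (2, 1); (2, 2)]%N -> 0 < e ->
  exists N, forall n j, (N <= n)%N -> (j <= 2)%N -> `|coefD k i n j| <= e.
Proof.
move=> ki e0; have g0 : 0 < 4 * (`|gam| + 1) by rewrite mulr_gt0// ltr_wpDl.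
have [M FM] := fdiff_lim alpha01 (divr_gt0 e0 g0).
exists (M + 5)%N => n j Mn j2; rewrite (le_trans (coefD_bound ki j2 _))//; first by lia.
have : fdiff (n - 4) <= e / (4 * (`|gam| + 1)) by apply: FM; lia.
rewrite ler_pdivlMr//; have := fdiff_ge0 alpha01 (n - 4); have := normr_ge0 gam.
set g := `|gam|; set f := fdiff _; nra.
Qed.

(** [omega (n - j)] is itself the coefficient of u_k at step n - j + k, so both parts of [wstart]
    are covered by [coefD_small]. *)
Lemma wstart_small k i (e : R) : (k, i) \in [:: (1, 1); (2, 1); (2, 2)]%N -> 0 < e ->
  exists N, forall n j, (N <= n)%N -> (j < k)%N -> `|wstart alpha dt k i n j| <= e.
Proof.
move=> ki e0; have k2 : (k <= 2)%N.
  by move: ki; rewrite !inE => /or3P[]; rewrite xpair_eqE => /andP[/eqP -> _].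
have [N CN] := coefD_small ki (divr_gt0 e0 (ltr0Sn _ 1)).
exists (N + 2)%N => n j Nn jk; rewrite /wstart /omega.
rewrite (le_trans (ler_normB _ _))// [leRHS](splitr e) lerD// CN//; by lia.
Qed.

End Weights.

(** * Stability *)

(** Structural recursion on the list [S n] of the first [n] values. *)
Lemma course_of_values (T : Type) (x0 : T) (F : nat -> (nat -> T) -> T) :
  (forall n f g, (forall j, (j < n)%N -> f j = g j) -> F n f = F n g) ->
  exists u, forall n, u n = F n u.
Proof.
move=> Floc; pose S := fix S n := if n is m.+1 then rcons (S m) (F m (nth x0 (S m))) else [::].
have szS n : size (S n) = n by elim: n => //= n IH; rewrite size_rcons IH.
pose u n := nth x0 (S n.+1) n.
have Su n j : (j < n)%N -> nth x0 (S n) j = u j.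
  elim: n => // n IH; rewrite ltnS leq_eqVlt => /orP[/eqP->//|jn].
  by rewrite /= nth_rcons szS jn IH.
exists u => n; rewrite {1}/u /= nth_rcons szS ltnn eqxx.
by apply: Floc => j jn; rewrite Su.
Qed.

Section Stability.
Context {R : realType}.
Variables (alpha dt : R) (k i : nat) (z : R[i]).
Local Notation om := (omega alpha dt k i).
Local Notation w := (wstart alpha dt k i).

Hypotheses (z0 : z != 0) (rez : Re z <= 0) (om0 : 0 <= om 0).

Let den : R[i] := z - (om 0)%:C.

(** Since Re z <= 0 <= om 0, equality of [z] and [om 0] would make both 0. Each step can therefore
    be solved for [u n]. *)
Let den_neq0 : den != 0.
Proof.
rewrite subr_eq0; apply: contra z0 => /eqP zE; move: rez om0; rewrite zE/= => o1 o2.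
by apply/eqP; congr (_ +i* _); apply/eqP; rewrite eq_le o1.
Qed.

Let step (n : nat) (u : nat -> R[i]) : R[i] :=
  den^-1 * (\sum_(j < k) (w n j)%:C * u j + \sum_(j < n) (om (n - j))%:C * u j).

Lemma recursionE (u : nat -> R[i]) :
  recursion alpha dt k i z u <-> forall n, (k <= n)%N -> u n = step n u.
Proof.
split=> H n kn; have := H n kn; rewrite /step.
  rewrite big_ord_recr/= subnn => E; apply: (mulfI den_neq0); rewrite mulVKf//.
  by rewrite /den mulrBl -E; ring.
move=> E; rewrite big_ord_recr/= subnn addrA.
have -> : \sum_(j < k) (w n j)%:C * u j + \sum_(j < n) (om (n - j))%:C * u j = den * u n.
  by rewrite E mulVKf.
by rewrite /den; ring.
Qed.

Lemma recursion_exists (u0 : nat -> R[i]) : exists u,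
  (forall j, (j < k)%N -> u j = u0 j) /\ recursion alpha dt k i z u.
Proof.
have [|u uE] := @course_of_values _ (0 : R[i])
  (fun n u => if (n < k)%N then u0 n else step n u).
  move=> n f g fg; case: ltnP => // kn; rewrite /step; congr (_ * (_ + _)).
    by apply: eq_bigr => j _; rewrite fg// (leq_trans _ kn).
  by apply: eq_bigr => j _; rewrite fg.
exists u; split => [j jk|]; first by rewrite uE jk.
by apply/recursionE => n kn; rewrite uE ltnNge kn.
Qed.

Lemma recursion_unique (u v : nat -> R[i]) : (forall j, (j < k)%N -> u j = v j) ->
  recursion alpha dt k i z u -> recursion alpha dt k i z v -> forall n, u n = v n.
Proof.
move=> uv /recursionE ru /recursionE rv; elim/ltn_ind => n IH.
have [nk|kn] := ltnP n k; first exact: uv.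
rewrite ru// rv// /step; congr (_ * (_ + _)).
  by apply: eq_bigr => j _; rewrite IH// (leq_trans _ kn).
by apply: eq_bigr => j _; rewrite IH.
Qed.

Variables (gam : R) (c : bool) (e b : nat -> R).
Hypothesis gam0 : 0 <= gam.
Hypothesis omE : forall m, om m = gam * symbol c e b m.
Hypothesis w_gam0 : gam = 0 -> forall n j, w n j = 0.
Hypothesis w_small : forall eta : R, 0 < eta ->
  exists N, forall n j, (N <= n)%N -> (j < k)%N -> `|w n j| <= eta.
Hypotheses (e_ge0 : forall m, 0 <= e m) (e_noninc : forall m, e m.+1 <= e m).
Hypothesis e_lim : forall eta : R, 0 < eta -> exists M, e M <= eta.
Hypothesis e_strict : e 1 < e 0.
Hypotheses (b_ge0 : forall m, 0 <= b m).
Hypothesis b_convex : forall m, 2 * b m.+1 <= b m + b m.+2.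
Hypothesis b_lim : forall eta : R, 0 < eta ->
  exists M, forall m, (M <= m)%N -> b m <= eta.

Lemma forcing_null (u : nat -> R[i]) : null (fun n => \sum_(j < k) (w n j)%:C * u j).
Proof.
move=> eta eta0; pose U := 1 + \sum_(j < k) normc (u j).
have U0 : 0 < U by rewrite ltr_pwDl// sumr_ge0// => j _; exact: normc_ge0.
have [N wN] := w_small (divr_gt0 eta0 U0); exists N => n Nn.
rewrite (le_trans (normc_sum _ _ _))//.
apply: (@le_trans _ _ (\sum_(j < k) eta / U * normc (u j))).
  by apply: ler_sum => j _; rewrite normcM normc_real ler_wpM2r ?normc_ge0 ?wN.
rewrite -mulr_sumr mulrAC ler_pdivrMr// ler_pM2l// /U lerDr//.
Qed.

Lemma recursion_null (u : nat -> R[i]) : recursion alpha dt k i z u -> null u.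
Proof.
(* If [gam] is 0 all weights vanish and the recursion reads z u_n = 0. *)
move=> ru; have [g0|gN0] := eqVneq gam 0.
  have uz n : (k <= n)%N -> 0 = u n.
    move=> /ru; rewrite !big1 ?addr0 => [/esym/eqP|j _|j _].
    - by rewrite mulf_eq0 (negbTE z0)/= => /eqP.
    - by rewrite omE g0 mul0r mul0r.
    - by rewrite w_gam0// mul0r.
  by apply: (eq_null uz) => eta eta0; exists 0%N => n _; rewrite normc0 ltW.
have {gN0}gp : 0 < gam by rewrite lt_def gN0.
(* Defining [g] as the defect makes the convolution equation hold for every n; from n = k on it is
   the forcing by the starting values. *)
pose g n := z * u n - conv (fun m => (om m)%:C) u n.
have ng : null g.
  apply: (@eq_null _ _ _ k _ (forcing_null u)) => n kn; rewrite /g /conv.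
  by rewrite -(ru n kn) addrK.
apply: (@wiener_stability _ om (gam * (e 0 - e 1)) z u g _ _ z0 rez ng).
- by rewrite mulr_gt0// subr_gt0.
- move=> eta eta0.
  have [p [ap pc p1]] := symbol_approx c e_ge0 e_noninc e_lim b_ge0 b_convex b_lim
    (divr_gt0 eta0 gp).
  exists (gam *: p); split.
  + move=> n; apply: (@le_trans _ _ (gam * (eta / gam))); last first.
      by rewrite mulrC divfK ?gt_eqF.
    rewrite -ler_pdivrMl// mulrC -[leLHS]mulrC; apply: le_trans (ap n).
    rewrite mulr_sumr ler_sum// => j _; rewrite coefZ omE -mulrBr normrM gtr0_norm//.
    by rewrite mulKf// gt_eqF.
  + move=> x x1; rewrite -/(reval x _) revalZ -mulrA ler_pM2l//; exact: pc.
  + by rewrite hornerZ p1 mulr0.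
- by move=> n; rewrite /g opprB addrC subrK.
Qed.

Lemma recursion_stable : in_stab_region alpha dt k i z.
Proof.
move=> u0; split; first exact: recursion_exists; split.
  move=> u v uu0 ru vu0 rv; apply: recursion_unique => // j jk.
  by rewrite uu0// vu0.
move=> u _ /recursion_null nu; apply/cvgrPdist_le => eta eta0.
have [N uN] := nu _ eta0; exists N => // n /= Nn.
by rewrite sub0r normrN ger0_norm ?normc_ge0 ?uN.
Qed.

End Stability.

Lemma Gamma_ge0 (R : realType) (s : R) : 0 <= Defs.Gamma s.
Proof.
apply: fine_ge0; apply: integral_ge0 => x _.
by rewrite lee_fin mulr_ge0 ?powR_ge0 ?expR_ge0.
Qed.

Lemma sector_halfplane_Re (R : realType) (z : R[i]) : sector_halfplane z -> Re z <= 0.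
Proof.
move=> [_ [t [tI zE]]]; rewrite -oppr_ge0.
have -> : - Re z = Re (- z) by case: z {zE}.
by rewrite zE /= mul0r subr0 mulr_ge0 ?normc_ge0 ?cos_ge0_pihalf.
Qed.

Unset Implicit Arguments.

Theorem theorem3p11 (R : realType) (alpha dt : R) (k i : nat) :
  0 < alpha < 1 -> 0 < dt ->
  (k, i) \in [:: (1, 1); (2, 1); (2, 2)]%N ->
  forall z : R[i], sector_halfplane z -> in_stab_region alpha dt k i z.
Proof.
move=> alpha01 dt0 ki z sz; have rez := sector_halfplane_Re sz; have [z0 _] := sz.
pose gam := (Defs.Gamma (1 - alpha))^-1.
have gam0 : 0 <= gam by rewrite invr_ge0 Gamma_ge0.
have w0 : gam = 0 -> forall n j, wstart alpha dt k i n j = 0.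
  move=> g0; have c0 n j : Defs.coefD alpha dt k i n j = 0.
    by rewrite /Defs.coefD /Defs.Dfrac -/gam g0 mul0r mulr0.
  by move=> n j; rewrite /wstart /omega !c0 subrr.
have ws eta := @wstart_small _ alpha dt alpha01 dt0 k i eta ki.
have fl eta := @fdiff_lim _ alpha alpha01 eta.
have fl1 (eta : R) : 0 < eta -> exists M, fdiff alpha M <= eta.
  by move=> /fl[M /(_ M (leqnn M))]; exists M.
have rl (eta : R) : 0 < eta -> exists M, fright alpha M <= eta.
  by move=> /fl1[M]; exists M; exact: le_trans (fright_le_fdiff _ _) _.
have tl (eta : R) : 0 < eta -> exists M, forall m, (M <= m)%N -> ftrap alpha m <= eta.
  move=> /fl[M FM]; exists M => m /FM; exact: le_trans (ftrap_le_fdiff _ _).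
have f0 := fdiff_ge0 alpha01 0; have t0 := ftrap_ge0 alpha01.
have r0 := fright_ge0 alpha01.
(* The symbol has e = [fdiff], b = 0 for (1, 1), and e = [fright], b = [ftrap] for k = 2, with
   folding exactly for i = 2. *)
move: ki w0 ws; rewrite !inE => /or3P[] /eqP[-> ->] w0 ws.
- apply: (@recursion_stable _ alpha dt 1 1 z z0 rez _ gam false (fdiff alpha) (fun=> 0)) => //.
  + by rewrite omega11// mulr_ge0// /symbol /diff1 /=; lra.
  + exact: omega11.
  + exact: fdiff_ge0.
  + exact: fdiff_noninc.
  + exact: fdiff1_lt_fdiff0.
  + by move=> m; rewrite mulr0 addr0.
  + by move=> eta eta0; exists 0%N => m _; exact: ltW.
- apply: (@recursion_stable _ alpha dt 2 1 z z0 rez _ gam false (fright alpha) (ftrap alpha)) => //.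
  + by rewrite omega21// mulr_ge0// /symbol /diff1 /fold1 /=; have := t0 0%N; have := r0 0%N; lra.
  + exact: omega21.
  + exact: fright_noninc.
  + exact: fright1_lt_fright0.
  + exact: ftrap_convex.
- apply: (@recursion_stable _ alpha dt 2 2 z z0 rez _ gam true (fright alpha) (ftrap alpha)) => //.
  + rewrite omega22// mulr_ge0// /symbol /diff1 /fold1 /=.
    by have := t0 0%N; have := t0 1%N; have := r0 0%N; lra.
  + exact: omega22.
  + exact: fright_noninc.
  + exact: fright1_lt_fright0.
  + exact: ftrap_convex.
Qed.
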